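(* Let $\Omega\subset\mathbb R^d$ be a bounded convex body and let $P(D)=D^2+pD+q$ with constants $p,q\in\mathbb R$. Then $$R_n\big(W^{P(D)}_\infty(\Omega)\big)\le \frac14\left(\frac{\Theta(d)\,\mu_d(\Omega)}{\nu_d\, n}\right)^{2/d}(1+o(1))\qquad (n\to\infty),$$ i.e. $\limsup_{n\to\infty} n^{2/d}R_n\big(W^{P(D)}_\infty(\Omega)\big)\le \frac14\left(\frac{\Theta(d)\mu_d(\Omega)}{\nu_d}\right)^{2/d}$.
   Context: A convex body is a compact convex set with non-empty interior. $\mu_d$ is Lebesgue measure on $\mathbb R^d$, $\nu_d$ the volume of the unit ball of $\mathbb R^d$. Function class: for a convex body $\Omega$ and $P(D)=D^2+pD+q$, $W^{P(D)}_\infty(\Omega)$ is the set of $f:\Omega\to\mathbb R$ such that $f\in C^1(\Omega)$ and, for every unit vector $u\in\mathbb R^d$, the second directional derivative $\partial^2 f/\partial u^2$ exists in the generalized sense (for almost every line parallel to $u$ meeting the interior of $\Omega$, the restriction of $\partial f/\partial u$ to that line is locally absolutely continuous), and $\operatorname{ess\,sup}_{x\in\Omega}\big|\frac{\partial^2 f}{\partial u^2}(x)+p\frac{\partial f}{\partial u}(x)+qf(x)\big|\le1$. Recovery: for a finite set $\xi\subset\Omega$, the information is $I_\xi(f)=\{(f(x),\nabla f(x)):x\in\xi\}$. An algorithm is any map $\phi$ from the information to $C(\Omega)$. $R(W^{P(D)}_\infty(\Omega),\xi)=\inf_\phi\sup_{f\in W^{P(D)}_\infty(\Omega)}\|f-\phi(I_\xi(f))\|_\infty$,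 and $R_n(W^{P(D)}_\infty(\Omega))=\inf\{R(W^{P(D)}_\infty(\Omega),\xi):\xi\subset\Omega,\ \operatorname{card}\xi\le n\}$. Covering density: a covering of $\mathbb R^d$ is a countable family $\mathcal M$ of balls of equal radius whose union is $\mathbb R^d$; $\operatorname{dens}\mathcal M=\liminf_{R\to\infty}\sum_{B\in\mathcal M}\mu_d(B\cap[-R,R]^d)/\mu_d([-R,R]^d)$, and $\Theta(d)=\inf\{\operatorname{dens}\mathcal M:\mathcal M\text{ covers }\mathbb R^d\}$. *)

(* Defs.v *)
From HB Require Import structures.
From mathcomp Require Import all_boot all_order all_algebra.
From mathcomp Require Import all_classical all_reals all_analysis.
Set Implicit Arguments. Unset Strict Implicit. Unset Printing Implicit Defensive.
Import Order.TTheory GRing.Theory Num.Theory.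
Import numFieldNormedType.Exports.
Local Open Scope classical_set_scope.
Local Open Scope ring_scope.

Section defs.
Context {R : realType} {d : nat}.
Local Notation V := 'rV[R]_d.

Definition dotv (x y : V) : R := \sum_(i < d) x ord0 i * y ord0 i.
Definition enorm (x : V) : R := Num.sqrt (dotv x x).
Definition eball (c : V) (r : R) : set V := [set x | enorm (x - c) <= r].

Definition box (a b : V) : set V :=
  [set x | forall i, a ord0 i <= x ord0 i <= b ord0 i].
Definition box_vol (a b : V) : R := \prod_(i < d) (b ord0 i - a ord0 i).

Definition leb_outer (A : set V) : \bar R :=
  ereal_inf [set s | exists a b : nat -> V,
    [/\ (forall k i, a k ord0 i <= b k ord0 i),
        A `<=` \bigcup_k box (a k) (b k) &
        s = (\sum_(0 <= k <oo) (box_vol (a k) (b k))%:E)%E]].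

Definition unit_ball_vol : \bar R := leb_outer (eball 0 1).

Definition convex_body (O : set V) : Prop :=
  [/\ (forall x y (t : R), O x -> O y -> 0 <= t <= 1 -> O ((1 - t) *: x + t *: y)),
      compact O & interior O !=set0].

Definition C1_on (O : set V) (f : V -> R) (g : V -> V) : Prop :=
  {within O, continuous g} /\
  forall x, O x -> forall e : R, 0 < e -> exists2 del : R, 0 < del &
    forall y, O y -> enorm (y - x) < del ->
      `|f y - f x - dotv (g x) (y - x)| <= e * enorm (y - x).

Definition abs_cont_on (h : R -> R) (a b : R) : Prop :=
  forall e : R, 0 < e -> exists2 del : R, 0 < del &
    forall (n : nat) (s t : nat -> R),
      (forall k, (k < n)%N -> a <= s k <= t k /\ t k <= b) ->
      (forall k l, (k < n)%N -> (l < n)%N -> k <> l -> t k <= s l \/ t l <= s k) ->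
      \sum_(k < n) (t k - s k) < del ->
      \sum_(k < n) `|h (t k) - h (s k)| < e.

Definition loc_abs_cont_on (h : R -> R) (L : set R) : Prop :=
  forall a b, a <= b -> `[a, b] `<=` L -> abs_cont_on h a b.

Definition dir_deriv_line (g : V -> V) (u x : V) : R -> R :=
  fun t => dotv (g (x + t *: u)) u.

(* generalized second directional derivative condition for direction u:
   for a.e. x in the interior of O, (i) the restriction of du f to the line
   through x parallel to u (within the interior of O) is locally absolutely
   continuous, (ii) the second directional derivative exists at x and
   |d2u f + p du f + q f| <= 1 there.  (This encodes: a.e. line parallel to u
   is good, and ess sup |d2u f + p du f + q f| <= 1.) *)
Definition second_dir_cond (p q : R) (O : set V) (f : V -> R) (g : V -> V)
    (u : V) : Prop :=
  leb_outer [set x | interior O x /\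
     ~ (loc_abs_cont_on (dir_deriv_line g u x) [set t | interior O (x + t *: u)]
        /\ derivable (dir_deriv_line g u x) 0 1
        /\ `|derive1 (dir_deriv_line g u x) 0 + p * dotv (g x) u + q * f x| <= 1)]
  = 0%E.

(* W^{P(D)}_oo(O), as the set of pairs (f, grad f) *)
Definition WPD (p q : R) (O : set V) : set ((V -> R) * (V -> V)) :=
  [set fg | C1_on O fg.1 fg.2 /\
            forall u : V, enorm u = 1 -> second_dir_cond p q O fg.1 fg.2 u].

Definition info (xi : seq V) (fg : (V -> R) * (V -> V)) : seq (R * V) :=
  map (fun y => (fg.1 y, fg.2 y)) xi.

Definition alg_err (O : set V) (F : set ((V -> R) * (V -> V))) (xi : seq V)
    (phi : seq (R * V) -> V -> R) : \bar R :=
  ereal_sup [set e | exists fg x, [/\ F fg, O x &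
               e = (`|fg.1 x - phi (info xi fg) x|)%:E]].

Definition rec_err (O : set V) (F : set ((V -> R) * (V -> V))) (xi : seq V)
  : \bar R :=
  ereal_inf [set alg_err O F xi phi | phi in
               [set phi : seq (R * V) -> V -> R |
                  forall I, {within O, continuous (phi I)}]].

Definition Rn (O : set V) (F : set ((V -> R) * (V -> V))) (n : nat) : \bar R :=
  ereal_inf [set rec_err O F xi | xi in
               [set xi : seq V | [/\ uniq xi, (size xi <= n)%N &
                                     forall y, y \in xi -> O y]]].

Definition cube (T : R) : set V := [set x | forall i, `|x ord0 i| <= T].

Definition ball_covering (r : R) (c : nat -> V) : Prop :=
  0 < r /\ \bigcup_k eball (c k) r = setT.

Definition dens (r : R) (c : nat -> V) : \bar R :=
  ereal_sup [set ereal_inf [set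
     ((\sum_(0 <= k <oo) leb_outer (eball (c k) r `&` cube T))
        * ((fine (leb_outer (cube T)))^-1)%:E)%E
     | T in [set T | M <= T]] | M in [set: R]].

Definition Theta : \bar R :=
  ereal_inf [set e | exists (r : R) (c : nat -> V),
                      ball_covering r c /\ e = dens r c].
End defs.

(* Main.v *)
Require Import Defs.
From mathcomp Require Import all_boot all_order all_algebra.
From mathcomp Require Import all_classical all_reals all_analysis.
From mathcomp Require Import measurable_realfun ring lra.
Set Implicit Arguments. Unset Strict Implicit. Unset Printing Implicit Defensive.
Import Order.TTheory GRing.Theory Num.Theory.
Import numFieldNormedType.Exports.
Local Open Scope classical_set_scope.
Local Open Scope ring_scope.

(** The error of the optimal algorithm is governed by the functions [f] of the class
    that vanish to first order at the nodes.  For such an [f], the condition in all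
    directions gives a second order Taylor bound with constant
    [A = 1 + |p| sup |grad f| + |q| sup |f|]: restricted to almost every line, the
    directional derivative is absolutely continuous with derivative at most [A], and
    the remaining segments follow by continuity.  If every point has a node within
    distance [h], then [f] and its gradient are [O(h)], so [A = 1 + O(h)].

    If [|f|] attains its maximum at an interior point [x], the gradient vanishes both
    at [x] and at a node [y] with [|x - y| <= h]; expanding from both ends up to the
    midpoint of the segment gives [|f x| <= A h^2 / 4].  On a thin layer along the
    boundary it suffices to place nodes at distance [h / sqrt 2], which costs a
    negligible number of points.

    The nodes come from a covering of density close to [Theta]: it yields a finite
    covering of a cube by balls, a copy of which is placed in each cell of a fine
    grid that meets a slightly shrunk copy of the body.  Compactness and the
    definition of the outer measure bound the number of cells meeting the body from
    above, and subadditivity bounds the number of cells meeting the shrunk copy from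
    below, so that the cells of the boundary layer are few. *)

(** * Lebesgue outer measure and null sets *)

Section outer_measure.
Context {R : realType} {d : nat}.
Local Notation V := 'rV[R]_d.
Implicit Types (A B : set V) (a b : V).

Lemma box_vol_ge0 a b : (forall i, a ord0 i <= b ord0 i) -> 0 <= box_vol a b.
Proof. by move=> ab; apply: prodr_ge0 => i _; rewrite subr_ge0. Qed.

Lemma leb_outer_ge0 A : (0 <= leb_outer A)%E.
Proof.
apply: le_ereal_inf_tmp => _ [a [b [ab _ ->]]].
by apply: nneseries_ge0 => k _ _; rewrite lee_fin box_vol_ge0.
Qed.

Lemma leb_outer_le A B : A `<=` B -> (leb_outer A <= leb_outer B)%E.
Proof.
move=> AB; apply: ereal_inf_le_tmp => s [a [b [ab Bc ->]]].
by exists a, b; split => // x /AB /Bc.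
Qed.

Lemma leb_outer_near A (e : R) : 0 < e -> leb_outer A \is a fin_num ->
  exists a b : nat -> V, [/\ (forall k i, a k ord0 i <= b k ord0 i),
        A `<=` \bigcup_k box (a k) (b k) &
        (\sum_(0 <= k <oo) (box_vol (a k) (b k))%:E < leb_outer A + e%:E)%E].
Proof.
move=> e0 /(lb_ereal_inf_adherent e0) [_ [a [b [ab Ac ->]]] lt].
by exists a, b; split.
Qed.

(** Countable subadditivity: the [n]-th set gets a cover with excess [e / 2 ^ n.+1], and the covers
    are merged into one sequence through a bijection of [nat] with [nat * nat]. *)
Lemma leb_outer_bigcup (A : nat -> set V) :
  (leb_outer (\bigcup_k A k) <= \sum_(0 <= k <oo) leb_outer (A k))%E.
Proof.
have [[i ioo]|] := pselect (exists i, leb_outer (A i) = +oo%E).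
  rewrite (eseries_pinfty _ _ ioo) ?leey// => n _.
  by rewrite -ltNye (lt_le_trans _ (leb_outer_ge0 _)).
rewrite -forallNE => Aoo.
have Afin k : leb_outer (A k) \is a fin_num.
  by rewrite ge0_fin_numE ?leb_outer_ge0// ltey; apply/eqP/Aoo.
apply/lee_addgt0Pr => e e0.
have Aep := epsilon_trick xpredT (fun n => leb_outer_ge0 (A n)) (ltW e0).
apply: le_trans Aep.
pose P n (ab : (nat -> V) * (nat -> V)) :=
  [/\ (forall k i, ab.1 k ord0 i <= ab.2 k ord0 i),
        A n `<=` \bigcup_k box (ab.1 k) (ab.2 k) &
        (\sum_(0 <= k <oo) (box_vol (ab.1 k) (ab.2 k))%:E <=
           leb_outer (A n) + (e / (2 ^ n.+1)%:R)%:E)%E].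
have [G PG] : {G & forall n, P n (G n)}.
  apply: (@choice _ _ P) => n.
  have en : 0 < e / (2 ^ n.+1)%:R by rewrite divr_gt0// ltr0n expn_gt0.
  have [a [b [ab Ac lt]]] := leb_outer_near en (Afin n).
  by exists (a, b); split => //; exact: ltW.
have v0 i j : (0 <= (box_vol ((G i).1 j) ((G i).2 j))%:E)%E.
  by rewrite lee_fin box_vol_ge0//; have [] := PG i.
have /card_esym/ppcard_eqP[f] := @card_nat2.
apply: (@le_trans _ _ (\sum_(0 <= i <oo) \sum_(0 <= j <oo)
    (box_vol ((G i).1 j) ((G i).2 j))%:E)%E); last first.
  apply: lee_nneseries => [i _ _|n _]; last by have [] := PG n.
  exact: nneseries_ge0.
apply: ereal_inf_lbound => /=.
exists (fun n => (G (f n).1).1 (f n).2), (fun n => (G (f n).1).2 (f n).2); split.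
- by move=> k i; have [] := PG (f k).1.
- move=> x [n _]; have [_ + _] := PG n => /[apply] -[k _ xk].
  by exists (f^-1%FUN (n, k)) => //=; rewrite invK ?inE.
- rewrite [RHS]nneseries_esumT//.
  rewrite nneseries_esumT; last by move=> i; exact: nneseries_ge0.
  under eq_esum do rewrite nneseries_esumT//.
  rewrite esum_esum//.
  have -> : [set: nat] `*`` (fun=> [set: nat]) = [set: nat * nat].
    by apply/seteqP; split => // -[].
  rewrite (reindex_esum [set: nat] setT f)//.
Qed.


Lemma leb_outer_box a b : (0 < d)%N -> (forall i, a ord0 i <= b ord0 i) ->
  (leb_outer (box a b) <= (box_vol a b)%:E)%E.
Proof.
move=> d0 ab; apply: ereal_inf_lbound => /=.
(* The sequence is padded with the degenerate box at [0], whose volume is zero because [0 < d]; for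
   [d = 0] the empty product would give 1. *)
exists (fun k => if k is 0%N return V then a else 0),
  (fun k => if k is 0%N return V then b else 0).
split.
- by case.
- by move=> x xab; exists 0%N.
- rewrite nneseries_recl//; last first.
    by case=> [|k] _; rewrite lee_fin box_vol_ge0.
  rewrite [X in (_ + X)%E]eseries0 ?adde0//.
  move=> [//|k] _ _; rewrite /box_vol; case: d d0 => // n _.
  by rewrite big_ord_recl subrr mul0r.
Qed.

(** A cover of [B] by boxes pulls back along [x |-> w + l *: x] to a cover of [A] by boxes, each
    volume being divided by [l ^+ d]. *)
Lemma leb_outer_affine A B (w : V) (l : R) : 0 < l ->
  (forall x, A x -> B (w + l *: x)) ->
  ((l ^+ d)%:E * leb_outer A <= leb_outer B)%E.
Proof.
move=> l0 AB; apply: le_ereal_inf_tmp => _ [a [b [ab Bc ->]]].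
have l0' : l != 0 by rewrite gt_eqF.
have -> : (\sum_(0 <= k <oo) (box_vol (a k) (b k))%:E = (l ^+ d)%:E *
    \sum_(0 <= k <oo) (box_vol (l^-1 *: (a k - w)) (l^-1 *: (b k - w)))%:E)%E.
  rewrite -nneseriesZl; last first.
    move=> k _; rewrite lee_fin box_vol_ge0// => i; rewrite !mxE.
    by rewrite ler_pM2l ?invr_gt0// lerB.
  apply: eq_eseriesr => k _; rewrite -EFinM; congr (_%:E).
  rewrite /box_vol -[in l ^+ d](card_ord d) -prodr_const -big_split/=.
  by apply: eq_bigr => i _; rewrite !mxE; field.
rewrite lee_pmul2l// ?lte_fin ?exprn_gt0//.
apply: ereal_inf_lbound => /=.
exists (fun k => l^-1 *: (a k - w)), (fun k => l^-1 *: (b k - w)); split => //.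
  by move=> k i; rewrite !mxE ler_pM2l ?invr_gt0// lerB.
move=> x /AB/Bc[k _ xk]; exists k => // i; move: (xk i); rewrite !mxE.
rewrite ler_pdivrMl// ler_pdivlMl// => /andP[? ?]; apply/andP; split; lra.
Qed.

Lemma leb_outer_setU0 A B : leb_outer A = 0%E -> leb_outer B = 0%E ->
  leb_outer (A `|` B) = 0%E.
Proof.
move=> A0 B0; apply/eqP; rewrite eq_le leb_outer_ge0 andbT.
have -> : A `|` B = \bigcup_k (if k is 0%N then A else B).
  apply/seteqP; split => [x [Ax|Bx]|x [[|k] _ xx]]; first by exists 0%N.
  - by exists 1%N.
  - by left.
  - by right.
apply: (le_trans (leb_outer_bigcup _)).
by rewrite eseries0// => -[|k].
Qed.

End outer_measure.

(** * Slices of null sets by coordinate hyperplanes *)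

Section slicing.
Context {R : realType}.
Local Notation mu := (@lebesgue_measure R).

Definition consv {d} (y : R) (z : 'rV[R]_d) : 'rV[R]_d.+1 :=
  \row_i (if unlift ord0 i is Some j then z ord0 j else y).
Definition tailv {d} (x : 'rV[R]_d.+1) : 'rV[R]_d := \row_j x ord0 (lift ord0 j).

Lemma consv0 d y (z : 'rV[R]_d) : consv y z ord0 ord0 = y.
Proof. by rewrite mxE unlift_none. Qed.

Lemma consvS d y (z : 'rV[R]_d) j : consv y z ord0 (lift ord0 j) = z ord0 j.
Proof. by rewrite mxE liftK. Qed.

Lemma box_vol_recl d (a b : 'rV[R]_d.+1) :
  box_vol a b = (b ord0 ord0 - a ord0 ord0) * box_vol (tailv a) (tailv b).
Proof.
rewrite /box_vol big_ord_recl; congr (_ * _).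
by apply: eq_bigr => i _; rewrite !mxE.
Qed.

(* The predicate [S] selects the boxes meeting the slice; the others cannot be
   replaced by boxes of volume zero when [d = 0]. *)
Lemma ae_slice_cover d (N : set 'rV[R]_d.+1) : leb_outer N = 0%E ->
  {ae mu, forall y, forall e : R, 0 < e ->
    exists a b : nat -> 'rV[R]_d, exists S : nat -> bool,
    [/\ forall k i, a k ord0 i <= b k ord0 i,
        [set z | N (consv y z)] `<=` \bigcup_(k in [set k | S k]) box (a k) (b k) &
        (\sum_(0 <= k <oo) (box_vol (a k) (b k) * (S k)%:R)%:E < e%:E)%E]}.
Proof.
move=> N0.
pose P (m : nat) (ab : (nat -> 'rV[R]_d.+1) * (nat -> 'rV[R]_d.+1)) :=
  [/\ (forall k i, ab.1 k ord0 i <= ab.2 k ord0 i),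
        N `<=` \bigcup_k box (ab.1 k) (ab.2 k) &
        (\sum_(0 <= k <oo) (box_vol (ab.1 k) (ab.2 k))%:E <= (m.+1%:R^-1)%:E)%E].
have [G PG] : {G & forall n, P n (G n)}.
  apply: (@choice _ _ P) => n.
  have [||a [b [ab Ac]]] := @leb_outer_near _ _ N n.+1%:R^-1 => //.
    by rewrite N0.
  by rewrite N0 add0e => /ltW; exists (a, b).
pose S m k y : bool := (G m).1 k ord0 ord0 <= y <= (G m).2 k ord0 ord0.
pose I m k : set R := `[(G m).1 k ord0 ord0, (G m).2 k ord0 ord0]%classic.
pose Q m k := box_vol (tailv ((G m).1 k)) (tailv ((G m).2 k)).
have Q0 m k : 0 <= Q m k.
  by rewrite /Q box_vol_ge0// => i; rewrite !mxE; have [] := PG m.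
(* [f m k y] is the volume of the slice at height [y] of the [k]-th box of the [m]-th cover, and
   [F m y] the sum over [k]. By Tonelli, the integral of [F m] is the volume of the [m]-th cover, at
   most [m.+1%:R^-1]. *)
pose f m k (y : measurableTypeR R) : \bar R := ((Q m k)%:E * (\1_(I m k) y)%:E)%E.
pose F m y : \bar R := (\sum_(0 <= k <oo) f m k y)%E.
have F0' m k y : (0 <= f m k y)%E.
  by rewrite mule_ge0// lee_fin.
have m1 m k : measurable_fun [set: measurableTypeR R] (fun y : measurableTypeR R => (\1_(I m k) y : R)%:E).
  by apply/measurable_EFinP; apply: measurable_indic; exact: measurable_itv.
have mF' m k : measurable_fun [set: measurableTypeR R] (f m k).
  by rewrite /f; apply: measurable_funeM; exact: m1.
have F0 m y : (0 <= F m y)%E by exact: nneseries_ge0.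
have mF m : measurable_fun [set: measurableTypeR R] (F m).
  exact: (@ge0_emeasurable_sum _ _ _ setT (f m) xpredT).
have i1 m k : (\int[mu]_y (\1_(I m k) y)%:E =
    ((G m).2 k ord0 ord0 - (G m).1 k ord0 ord0)%:E)%E.
  rewrite integral_indic//; last exact: measurable_itv.
  rewrite setIT.
  apply: etrans (lebesgue_measure_itv
    `[(G m).1 k ord0 ord0, (G m).2 k ord0 ord0]) _.
  rewrite /= lte_fin -EFinB.
  case: ltP => //; have [/(_ k ord0) ab _ _] := PG m => ba.
  by congr EFin; apply/esym/eqP; rewrite subr_eq0 eq_le ab ba.
have iF m : (\int[mu]_y F m y <= (m.+1%:R^-1)%:E)%E.
  rewrite integral_nneseries//.
  have [ab _] := PG m; apply: le_trans.
  apply: lee_nneseries => [k _ _|k _]; first exact: integral_ge0.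
  rewrite ge0_integralZl ?lee_fin//.
  rewrite i1 box_vol_recl mulrC EFinM.
  apply: lee_wpmul2l; first by rewrite lee_fin.
  by rewrite lee_fin.
(* The infimum over all covers has integral zero, so it vanishes for almost every [y]; at such a [y]
   some cover has slices of total volume below any given [e]. *)
pose H y := einfs (F ^~ y) 0.
have HF m y : (H y <= F m y)%E by apply: ereal_inf_lbound => /=; exists m.
have H0 y : (0 <= H y)%E.
  by apply: le_ereal_inf_tmp => _ [m _ <-].
have mH : measurable_fun [set: measurableTypeR R] H by exact: measurable_fun_einfs.
have iH : (\int[mu]_y H y = 0)%E.
  apply/eqP; rewrite eq_le integral_ge0// andbT.
  apply/lee_addgt0Pr => e e0; rewrite add0e.
  have [m me] : exists m : nat, m.+1%:R^-1 < e.
    have [m _ /(_ m (leqnn m))] := near_infty_natSinv_lt (PosNum e0).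
    by exists m.
  apply: (@le_trans _ _ (\int[mu]_y F m y)%E).
    by apply: ge0_le_integral.
  by apply: (le_trans (iF m)); rewrite lee_fin ltW.
have : {ae mu, forall y, H y = 0%E}.
  have /(ae_eq_integral_abs mu (measurableT)) : measurable_fun [set: measurableTypeR R] H by [].
  rewrite (_ : (\int[mu]_y `|H y| = \int[mu]_y H y)%E); last first.
    by apply: eq_integral => y _; rewrite gee0_abs.
  rewrite iH => -[/(_ erefl) + _].
  by apply: filterS => y /(_ Logic.I).
apply: filterS => y Hy e e0.
have : (H y < e%:E)%E by rewrite Hy lte_fin.
move=> /ereal_inf_lt[_ [m _ <-]] Fe.
exists (fun k => tailv ((G m).1 k)), (fun k => tailv ((G m).2 k)), (S m ^~ y).
have [ab cov _] := PG m; split.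
- by move=> k i; rewrite !mxE.
- move=> z /cov[k _ xk]; exists k => /=.
    by have := xk ord0; rewrite consv0.
  by move=> i; have := xk (lift ord0 i); rewrite consvS !mxE.
- apply: le_lt_trans Fe; rewrite /F le_eqVlt; apply/orP; left; apply/eqP.
  apply: eq_eseriesr => k _; rewrite /f -EFinM; congr (_ * _)%:E.
  rewrite indicE; congr (_%:R); apply: congr1.
  by apply/idP/idP; rewrite inE /I /S /= in_itv.
Qed.

Lemma ae_slice_null d (N : set 'rV[R]_d.+1) : (0 < d)%N -> leb_outer N = 0%E ->
  {ae mu, forall y, leb_outer [set z | N (consv y z)] = 0%E}.
Proof.
move=> d0 /ae_slice_cover; apply: (@filterS _ _ (ae_filter_ringOfSetsType mu)) => y Hy.
apply/eqP; rewrite eq_le leb_outer_ge0 andbT.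
apply/lee_addgt0Pr => e /Hy[a [b [S [ab cov lt]]]]; rewrite add0e.
apply: le_trans (ltW lt); apply: ereal_inf_lbound => /=.
exists (fun k => if S k then a k else 0), (fun k => if S k then b k else 0); split.
- by move=> k i; case: ifP.
- by move=> z /cov [k /= Sk xk]; exists k => //; rewrite Sk.
- apply: eq_eseriesr => k _; case: ifP => _; rewrite ?mulr1// mulr0.
  rewrite /box_vol; case: d d0 {N Hy a b ab cov lt} => // n _.
  by rewrite big_ord_recl subrr mul0r.
Qed.

(** The slices live in dimension 0, where every box has volume 1. A cover of total volume below 1
    therefore selects no box, and the slice is empty. *)
Lemma ae_notin_null1 (N : set 'rV[R]_1) : leb_outer N = 0%E ->
  {ae mu, forall y, ~ N (consv y 0)}.
Proof.
move=> /ae_slice_cover; apply: (@filterS _ _ (ae_filter_ringOfSetsType mu)) => y /(_ 1 ltr01)[a [b [S [ab cov lt]]]] Ny.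
have [k /= Sk _] := cov _ Ny.
move: lt; rewrite ltNge => /negP; apply.
rewrite (@nneseriesD1 _ _ k)//; last first.
  by move=> n _; rewrite lee_fin mulr_ge0// box_vol_ge0.
rewrite Sk mulr1 /box_vol big_ord0 leeDl// nneseries_ge0//.
by move=> n _ _; rewrite lee_fin mulr_ge0// box_vol_ge0.
Qed.

End slicing.

(** * Lines on which a null set leaves a null trace *)

Section null_lines.
Context {R : realType}.
Local Notation mu := (@lebesgue_measure R).

Lemma ae_exists_itv (P : R -> Prop) (a b : R) : a < b ->
  {ae mu, forall y, P y} -> exists2 y, a < y < b & P y.
Proof.
move=> ab [A [mA A0 PA]]; apply: contrapT => nP.
have sub : `]a, b[ `<=` A.
  move=> y; rewrite /= in_itv/= => yab; apply: PA => /= Py.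
  by apply: nP; exists y.
have : (mu `]a, b[ <= mu A)%E by apply: le_measure; rewrite ?inE.
by rewrite A0 lebesgue_measure_itv/= lte_fin ab -EFinB lee_fin leNgt subr_gt0 ab.
Qed.

(** Induction on the dimension: if the box were null, some height between its faces would have a
    null slice, and that slice is a non-degenerate box of one dimension less. *)
Lemma leb_outer_box_neq0 d (a b : 'rV[R]_d.+1) :
  (forall i, a ord0 i < b ord0 i) -> leb_outer (box a b) <> 0%E.
Proof.
elim: d a b => [|d IH] a b ab N0.
  have [y /andP[ay yb]] := ae_exists_itv (ab ord0) (ae_notin_null1 N0).
  apply=> i; case: (unliftP ord0 i) => [[]//|->].
  by rewrite consv0 (ltW ay) (ltW yb).
have [y /andP[ay yb]] := ae_exists_itv (ab ord0) (ae_slice_null (ltn0Sn d) N0).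
have -> : [set z | box a b (consv y z)] = box (tailv a) (tailv b).
  apply/seteqP; split => z zab i.
    by have := zab (lift ord0 i); rewrite consvS !mxE.
  case: (unliftP ord0 i) => [j ->|->]; last by rewrite consv0 (ltW ay) (ltW yb).
  by have := zab j; rewrite consvS !mxE.
by apply: IH => i; rewrite !mxE.
Qed.

(** The counterpart of [consv] at the last coordinate: slicing removes coordinates from the front,
    so that the last one remains as the parameter of a line. *)
Definition rconsv {d} (y : 'rV[R]_d) (t : R) : 'rV[R]_d.+1 :=
  \row_i (if unlift ord_max i is Some j then y ord0 j else t).
Definition initv {d} (x : 'rV[R]_d.+1) : 'rV[R]_d := \row_j x ord0 (lift ord_max j).

Lemma rconsv_last d (y : 'rV[R]_d) t : rconsv y t ord0 ord_max = t.
Proof. by rewrite mxE unlift_none. Qed.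

Lemma initv_rconsv d (y : 'rV[R]_d) t : initv (rconsv y t) = y.
Proof. by apply/rowP => i; rewrite !mxE liftK. Qed.

Lemma rconsv_consv d y0 (y : 'rV[R]_d) t :
  rconsv (consv y0 y) t = consv y0 (rconsv y t).
Proof.
apply/rowP => i; rewrite [LHS]mxE.
case: (unliftP ord_max i) => [j ->|->]; last first.
  have -> : ord_max = lift ord0 ord_max :> 'I_d.+2 by apply/val_inj.
  by rewrite consvS rconsv_last.
case: (unliftP ord0 j) => [k ->|->]; last first.
  have -> : lift ord_max ord0 = ord0 :> 'I_d.+2 by apply/val_inj.
  by rewrite !consv0.
have -> : lift ord_max (lift ord0 k) = lift ord0 (lift ord_max k) :> 'I_d.+2.
  by apply/val_inj; rewrite /= /bump leq0n !add1n ltnS leqNgt ltn_ord.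
by rewrite !consvS mxE liftK.
Qed.

(** The leading coordinates are fixed one at a time, each within [e] of that of [w] and such that
    the slice stays null; what is left is a null set on a line. *)
Lemma null_ae_line n (N : set 'rV[R]_n.+1) (w : 'rV[R]_n) (e : R) :
  leb_outer N = 0%E -> 0 < e ->
  exists2 y : 'rV[R]_n, (forall i, `|y ord0 i - w ord0 i| < e) &
    {ae mu, forall t, ~ N (rconsv y t)}.
Proof.
move=> N0 e0; elim: n N w N0 => [|n IH] N w N0.
  exists 0; first by case.
  apply: (@filterS _ _ (ae_filter_ringOfSetsType mu)) (ae_notin_null1 N0) => t.
  rewrite (_ : consv t 0 = rconsv 0 t)//; apply/rowP => i.
  rewrite !mxE; case: unliftP => [[]//|_]; case: unliftP => [[]//|_//].
have we : w ord0 ord0 - e < w ord0 ord0 + e by lra.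
have [y0 /andP[y0l y0r]] := ae_exists_itv we (ae_slice_null (ltn0Sn n) N0).
move=> /IH-/(_ (tailv w))[y ye aey]; exists (consv y0 y).
  move=> i; case: (unliftP ord0 i) => [j ->|->].
    by have := ye j; rewrite consvS !mxE.
  by rewrite consv0 ltr_distl y0l y0r.
apply: (@filterS _ _ (ae_filter_ringOfSetsType mu)) aey => t.
by rewrite rconsv_consv.
Qed.

Lemma leb_outer_finite_boxes d (A : set 'rV[R]_d) m (a b : nat -> 'rV[R]_d) :
  (0 < d)%N -> (forall k i, (k < m)%N -> a k ord0 i <= b k ord0 i) ->
  (forall x, A x -> exists2 k, (k < m)%N & box (a k) (b k) x) ->
  (leb_outer A <= (\sum_(k < m) box_vol (a k) (b k))%:E)%E.
Proof.
move=> d0 ab Ac; apply: ereal_inf_lbound => /=.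
exists (fun k => if (k < m)%N then a k else 0),
  (fun k => if (k < m)%N then b k else 0); split.
- by move=> k i; case: ifP => // /ab.
- by move=> x /Ac[k km xk]; exists k => //; rewrite km.
- have v0 k : (m <= k)%N ->
    box_vol (if (k < m)%N then a k else 0) (if (k < m)%N then b k else 0) = 0.
    rewrite ltnNge => ->; rewrite /box_vol /=; case: d d0 {A a b ab Ac} => // n _.
    by rewrite big_ord_recl subrr mul0r.
  rewrite (@nneseries_split _ _ 0 m); last first.
    by move=> k _; rewrite lee_fin box_vol_ge0// => i; case: ifP => // /ab.
  rewrite add0n [X in (_ + X)%E]eseries0 ?adde0; last by move=> k mk _; rewrite v0.
  rewrite big_mkord -sumEFin; apply: eq_bigr => k _.
  by rewrite ltn_ord.
Qed.

(** The product is a polynomial in [t], hence continuous at 0. It is the volume of a box of sides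
    [c i] whose faces are all moved outwards by [t]. *)
Lemma prod_enlarge d (c : 'I_d -> R) (e : R) : 0 < e ->
  exists2 t0 : R, 0 < t0 & forall t, 0 <= t <= t0 ->
    \prod_i (c i + 2 * t) <= \prod_i c i + e.
Proof.
move=> e0; pose P : {poly R} := \prod_i ((c i)%:P + 2 *: 'X).
have PE t : P.[t] = \prod_i (c i + 2 * t).
  by rewrite horner_prod; apply: eq_bigr => i _; rewrite !hornerE.
have P0 : P.[0] = \prod_i c i.
  by rewrite PE; apply: eq_bigr => i _; rewrite mulr0 addr0.
have /(@cvgrPdist_lt _ _ _ _)/(_ e e0) : P.[t] @[t --> 0] --> P.[0].
  exact: continuous_horner.
move=> [t0 /= t00 H]; exists (t0 / 2); first by rewrite divr_gt0.
move=> t /andP[t_ge0 tt0].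
have /H : ball_ Num.norm 0 t0 t.
  by rewrite /ball_/= sub0r normrN ger0_norm//; lra.
by rewrite P0 PE distrC ltr_distl => /andP[_ /ltW].
Qed.

Lemma box_vol_recr d (a b : 'rV[R]_d.+1) :
  box_vol a b = box_vol (initv a) (initv b) * (b ord0 ord_max - a ord0 ord_max).
Proof.
rewrite /box_vol big_ord_recr; congr (_ * _).
apply: eq_bigr => i _; rewrite !mxE.
suff -> : widen_ord (leqnSn d) i = lift ord_max i by [].
by apply/val_inj; rewrite /= /bump leqNgt ltn_ord.
Qed.

(** Pairs of an offset [y] and a time [t] in [[0, L]] with [x + y + t *: u] in [N]. The extra
    dimension turns lines in direction [u] into lines parallel to a coordinate axis, without a
    rotation. *)
Definition shear {d} (x u : 'rV[R]_d) (L : R) (N : set 'rV[R]_d) : set 'rV[R]_d.+1 :=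
  [set z : 'rV[R]_d.+1 | 0 <= z ord0 ord_max <= L /\ N (x + initv z + z ord0 ord_max *: u)].

(** The time interval is cut into [m.+1] layers of length [tau]. Within a layer the box moves by at
    most [tau] in each coordinate, so the layer fits into a box whose spatial faces are moved
    outwards by [tau]. *)
Lemma leb_outer_shear_box d (a b x u : 'rV[R]_d) (L : R) :
  0 < L -> (forall i, `|u ord0 i| <= 1) -> (forall i, a ord0 i <= b ord0 i) ->
  (leb_outer (shear x u L (box a b)) <= (L * box_vol a b)%:E)%E.
Proof.
move=> L0 u1 ab; apply/lee_addgt0Pr => e e0.
have [t0 t00 Ht0] := prod_enlarge (fun i => b ord0 i - a ord0 i) (divr_gt0 e0 L0).
(* [m] makes the layer length [L / m.+1%:R] at most [t0], so that the enlargement costs at most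
   [e / L] in volume. *)
have [m] := ltr_add_invr (divr_gt0 t00 L0); rewrite add0r ltr_pdivlMr// => mt0.
pose tau := L / m.+1%:R.
have tau0 : 0 < tau by rewrite divr_gt0.
have taut0 : tau <= t0 by rewrite /tau mulrC ltW.
have mtau : m.+1%:R * tau = L by rewrite /tau mulrC divfK.
pose lo (j : nat) := rconsv (a - x - (j%:R * tau) *: u - const_mx tau) (j%:R * tau).
pose hi (j : nat) := rconsv (b - x - (j%:R * tau) *: u + const_mx tau) (j.+1%:R * tau).
have lohi j i : lo j ord0 i <= hi j ord0 i.
  case: (unliftP ord_max i) => [k ->|->]; last first.
    by rewrite !rconsv_last ler_wpM2r ?ltW// ltr_nat.
  by have := ab k; rewrite !mxE !liftK !mxE; lra.
apply: (@le_trans _ _ (\sum_(k < m.+1) box_vol (lo k) (hi k))%:E).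
  apply: leb_outer_finite_boxes => //= z [/andP[z0 zL] zab].
  set t := z ord0 ord_max in z0 zL zab.
  have [j jm /andP[jt tj]] : exists2 j, (j < m.+1)%N & j%:R * tau <= t <= j.+1%:R * tau.
    have /truncn_itv/andP[h1 h2] : 0 <= t / tau by rewrite divr_ge0// ltW.
    (* At [t = L] the truncation reaches [m.+1]; the point then belongs to the last layer,
       [j = m]. *)
    have [jm|jm] := ltnP (Num.truncn (t / tau)) m.+1.
      exists (Num.truncn (t / tau)) => //.
      by rewrite -ler_pdivlMr// h1 -ler_pdivrMr// ltW.
    exists m => //; rewrite mtau zL andbT.
    rewrite -ler_pdivlMr//; apply: le_trans h1; rewrite ler_nat.
    exact: leq_trans jm.
  exists j => // i; case: (unliftP ord_max i) => [k ->|->]; last first.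
    by rewrite !rconsv_last jt tj.
  have := zab k; rewrite !mxE !liftK !mxE -/t => /andP[za zb].
  have : `|(t - j%:R * tau) * u ord0 k| <= tau.
    rewrite normrM -[leRHS]mulr1; apply: ler_pM => //.
    rewrite ger0_norm ?subr_ge0//; move: tj; rewrite -natr1 mulrDl mul1r; lra.
  rewrite ler_norml mulrBl => /andP[h1 h2]; apply/andP; split; lra.
have vE k : box_vol (lo k) (hi k) =
    tau * \prod_i (b ord0 i - a ord0 i + 2 * tau).
  rewrite box_vol_recr !initv_rconsv !rconsv_last -natr1 mulrDl mul1r.
  rewrite (_ : k%:R * tau + tau - k%:R * tau = tau); last by ring.
  rewrite mulrC; congr (_ * _); apply: eq_bigr => i _.
  by rewrite !mxE; ring.
rewrite (eq_bigr _ (fun (k : 'I_m.+1) _ => vE k)) sumr_const card_ord -EFinD lee_fin.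
rewrite -[leLHS]mulr_natl mulrA mtau.
have -> : L * box_vol a b + e = L * (box_vol a b + e / L).
  by rewrite mulrDr [e / L]mulrC mulrA mulfV ?mul1r ?gt_eqF.
by rewrite ler_pM2l//; apply: Ht0; rewrite ltW.
Qed.

Lemma leb_outer_shear_null d (N : set 'rV[R]_d) (x u : 'rV[R]_d) (L : R) :
  0 < L -> (forall i, `|u ord0 i| <= 1) -> leb_outer N = 0%E ->
  leb_outer (shear x u L N) = 0%E.
Proof.
move=> L0 u1 N0; apply/eqP; rewrite eq_le leb_outer_ge0 andbT.
apply/lee_addgt0Pr => e e0; rewrite add0e.
have [||a [b [ab cov]]] := @leb_outer_near _ _ N (e / L); rewrite ?divr_gt0 ?N0//.
rewrite add0e => /ltW lt.
pose C k := shear x u L (box (a k) (b k)).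
apply: (@le_trans _ _ (leb_outer (\bigcup_k C k))).
  by apply: leb_outer_le => z [zL /cov[k _ zk]]; exists k.
apply: (le_trans (leb_outer_bigcup _)).
apply: (@le_trans _ _ (\sum_(0 <= k <oo) (L%:E * (box_vol (a k) (b k))%:E))%E).
  apply: lee_nneseries => [k _ _|k _]; first exact: leb_outer_ge0.
  exact: leb_outer_shear_box.
rewrite nneseriesZl; last by move=> k _; rewrite lee_fin box_vol_ge0.
rewrite -lee_pdivlMl// -EFinM mulrC//.
Qed.

(** The sheared set is null, so some offset within [e] of [x] gives a null line along its last
    coordinate; that line runs through the segment in direction [u]. *)
Lemma null_ae_direction d (N : set 'rV[R]_d) (x u : 'rV[R]_d) (L e : R) :
  0 < L -> 0 < e -> (forall i, `|u ord0 i| <= 1) -> leb_outer N = 0%E ->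
  exists2 y : 'rV[R]_d, (forall i, `|y ord0 i - x ord0 i| < e) &
    {ae mu, forall t, 0 <= t <= L -> ~ N (y + t *: u)}.
Proof.
move=> L0 e0 u1 /(leb_outer_shear_null 0 L0 u1) N0.
have [y yx aey] := null_ae_line x N0 e0; exists y => //; apply: (@filterS _ _ (ae_filter_ringOfSetsType mu)) aey => t H tL Nt.
by apply: H; rewrite /shear/= rconsv_last initv_rconsv add0r.
Qed.

End null_lines.

(** * Absolutely continuous functions with bounded derivative *)

Section absolute_continuity.
Context {R : realType}.
Local Notation mu := (@lebesgue_measure R).

(* The bound [A t] on the increment of [h] may fail on an open set [U] of small
   measure; [ac_admissible U h A t] allows for the variation of [h] over finitely
   many intervals of total length at most [mu (U `&` `[0, t])]. *)
Definition ac_admissible (U : set (measurableTypeR R)) (h : R -> R) (A t : R) : Prop :=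
  exists n (s s' : nat -> R),
    [/\ forall k, (k < n)%N -> 0 <= s k <= s' k /\ s' k <= t,
        forall k l, (k < n)%N -> (l < n)%N -> k <> l -> s' k <= s l \/ s' l <= s k,
        ((\sum_(k < n) (s' k - s k))%:E <= mu (U `&` `[0%R, t]))%E &
        `|h t - h 0| <= A * t + \sum_(k < n) `|h (s' k) - h (s k)| ].

Lemma ac_admissible_lip (U : set (measurableTypeR R)) (h : R -> R) (A t t' : R) : measurable U -> t <= t' ->
  ac_admissible U h A t -> `|h t' - h t| <= A * (t' - t) ->
  ac_admissible U h A t'.
Proof.
move=> mU tt' [n [s [s' [s0 sd sm sh]]]] htt'; exists n, s, s'; split => //.
- by move=> k /s0[-> st]; split => //; exact: le_trans st tt'.
- apply: (le_trans sm); apply: le_measure; rewrite ?inE//.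
  + by apply: measurableI => //; exact: measurable_itv.
  + by apply: measurableI => //; exact: measurable_itv.
  + apply: setIS => x; rewrite /= !in_itv/= => /andP[-> xt]; exact: le_trans xt tt'.
- have : `|h t' - h 0| <= `|h t' - h t| + `|h t - h 0|.
    by rewrite (le_trans _ (ler_normD _ _))// addrA subrK.
  by move=> /le_trans; apply; lra.
Qed.

(** Inside [U] the whole increment from [t] to [t'] is charged to the variation, by adding [[t, t']]
    to the family of intervals. *)
Lemma ac_admissible_open (U : set (measurableTypeR R)) (h : R -> R) (A t t' : R) : measurable U ->
  0 <= A -> 0 <= t -> t <= t' ->
  ac_admissible U h A t -> `[t, t'] `<=` U -> ac_admissible U h A t'.
Proof.
move=> mU A0 t0 tt' [n [s [s' [s0 sd sm sh]]]] tU.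
exists n.+1, (fun k => if (k < n)%N then s k else t),
  (fun k => if (k < n)%N then s' k else t'); split.
- move=> k _; case: ifP => kn; last by rewrite t0 tt'.
  by have [-> st] := s0 k kn; split => //; exact: le_trans st tt'.
- move=> k l kn ln kl.
  case: ifPn => kn'; case: ifPn => ln'; first exact: sd.
  + by left; have [] := s0 k kn'.
  + by right; have [] := s0 l ln'.
  + move: kn ln kn' ln'; rewrite !ltnS -!leqNgt => k1 l1 k2 l2.
    by exfalso; apply: kl; apply/eqP; rewrite eqn_leq (leq_trans k1 l2) (leq_trans l1 k2).
- rewrite big_ord_recr/= ltnn.
  under eq_bigr do rewrite ltn_ord.
  have mI r : measurable (U `&` `[0, r] : set (measurableTypeR R)).
    by apply: measurableI => //; exact: measurable_itv.
  apply: (@le_trans _ _ (mu ((U `&` `[0, t]) `|` `]t, t']))); last first.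
    apply: le_measure; rewrite ?inE//.
      by apply: measurableU => //; exact: measurable_itv.
    move=> x [[Ux]|]; rewrite /= !in_itv/=.
      by move=> /andP[-> xt]; split => //; exact: le_trans xt tt'.
    move=> /andP[tx xt']; split; last by rewrite xt' (le_trans t0 (ltW tx)).
    by apply: tU; rewrite /= in_itv/= xt' (ltW tx).
  rewrite measureU//; last first.
    apply/seteqP; split => // x [[_]]; rewrite /= !in_itv/= => /andP[_ xt] /andP[tx _].
    by move: (lt_le_trans tx xt); rewrite ltxx.
  rewrite EFinD; apply: leeD => //.
  suff : ((t' - t)%:E <= mu `]t, t'])%E by [].
  rewrite lebesgue_measure_itv/= lte_fin -EFinB; case: ltP => // t't.
  by rewrite lee_fin subr_le0.
- rewrite big_ord_recr/= ltnn.
  under eq_bigr do rewrite ltn_ord.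
  have : `|h t' - h 0| <= `|h t' - h t| + `|h t - h 0|.
    by rewrite (le_trans _ (ler_normD _ _))// addrA subrK.
  move=> /le_trans; apply.
  have : A * t <= A * t' by exact: ler_wpM2l.
  by lra.
Qed.

(** Continuous induction along [[0, L]]. The exceptional null set is enclosed in an open [U] of
    measure below the [del] of absolute continuity, so the variation charged to [U] stays below
    [e2]; elsewhere [h] is locally Lipschitz with constant [A + e]. *)
Lemma abs_cont_lip (h : R -> R) (L A : R) : 0 < L -> 0 <= A ->
  abs_cont_on h 0 L ->
  {ae mu, forall t, 0 <= t <= L -> forall e : R, 0 < e ->
    exists2 del : R, 0 < del &
      forall s, `|s - t| < del -> `|h s - h t| <= (A + e) * `|s - t|} ->
  `|h L - h 0| <= A * L.
Proof.
move=> L0 A0 hAC [E [mE E0 sE]].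
apply/ler_addgt0Pr => e1 e10.
(* The error [e1] is shared: [e * L] pays for the slope [A + e], and [e2] for the variation inside
   [U]. *)
pose e := e1 / 2 / L; pose e2 := e1 / 2.
have e0 : 0 < e by rewrite !divr_gt0.
have e20 : 0 < e2 by rewrite divr_gt0.
have [del del0 Hdel] := hAC _ e20.
have [U [oU EU mUE]] : exists U : set R,
    [/\ open U, E `<=` U & (mu (U `\` E) < del%:E)%E].
  apply: lebesgue_regularity_outer => //.
  suff : (mu E < +oo)%E by [].
  by rewrite E0.
have mU : measurable (U : set (measurableTypeR R)) by exact: open_measurable.
have mUdel : (mu U < del%:E)%E.
  have -> : U = (U `\` E) `|` E.
    apply/seteqP; split => x; last by move=> [[]//|/EU].
    by move=> Ux; have [Ex|nEx] := pselect (E x); [right|left].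
  have mUE' : measurable (U `\` E : set (measurableTypeR R)) by exact: measurableD.
  rewrite measureU//; last by apply/seteqP; split => x // [[]].
  suff : (mu (U `\` E) + mu E < del%:E)%E by [].
  by rewrite E0 adde0.
have Ae0 : 0 <= A + e by rewrite addr_ge0// ltW.
pose S := [set t | 0 <= t <= L /\ ac_admissible U h (A + e) t].
have S0 : S 0.
  split; first by rewrite lexx ltW.
  exists 0%N, (fun=> 0), (fun=> 0); split => //.
  - by rewrite big_ord0.
  - by rewrite subrr normr0 big_ord0 mulr0 addr0.
have hS : has_sup S.
  by split; [exists 0|exists L => t [/andP[]]].
pose tau := sup S.
have tau0 : 0 <= tau by apply: sup_ubound => //; have [] := hS.
have tauL : tau <= L by apply: sup_le_ub => //; [exists 0|move=> t [/andP[]]].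
(* Admissibility crosses [tau]: through [ac_admissible_open] if [tau] lies in [E], otherwise through
   the Lipschitz estimate at [tau]. The latter compares values with [h tau] only, whence
   [t <= tau <= t']. *)
have [del1 del10 step] : exists2 del1 : R, 0 < del1 & forall t t',
    t <= tau -> tau <= t' -> `|t - tau| < del1 -> `|t' - tau| < del1 ->
    0 <= t -> ac_admissible U h (A + e) t -> ac_admissible U h (A + e) t'.
  have [Et|nE] := pselect (E tau).
    have /EU /(open_subball oU)[r r0 rU] := Et.
    have r2 : 0 < r / 2 by rewrite divr_gt0.
    exists (r / 2) => // t t' tt tt' tr tr' t0 adm.
    apply: (ac_admissible_open mU Ae0 t0 (le_trans tt tt')) adm _.
    move=> x; rewrite /= in_itv/= => /andP[tx xt'].
    apply: (rU (r / 2)) => //=; first by rewrite sub0r normrN gtr0_norm// ltr_pdivrMr// mulr2n mulrDr mulr1 ltrDl.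
    rewrite /ball/=; move: tr tr'; rewrite !ltr_norml; lra.
  have : ~ ~ (0 <= tau <= L -> forall e : R, 0 < e ->
    exists2 del : R, 0 < del &
      forall s, `|s - tau| < del -> `|h s - h tau| <= (A + e) * `|s - tau|).
    by move=> /sE.
  move=> /contrapT/(_ _ e e0)[|r r0 Hr]; first by rewrite tau0.
  exists r => // t t' tt tt' tr tr' t0 adm.
  apply: (ac_admissible_lip mU (le_trans tt tt') adm).
  have := Hr _ tr; have := Hr _ tr'.
  rewrite [X in _ <= _ * X]ger0_norm ?subr_ge0//.
  rewrite [X in _ -> _ <= _ * X -> _]ler0_norm ?subr_le0//.
  have : `|h t' - h t| <= `|h t' - h tau| + `|h t - h tau|.
    by rewrite [X in _ <= _ + X]distrC (le_trans _ (ler_normD _ _))// addrA subrK.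
  move=> h1 h2 h3; rewrite (le_trans h1)// (le_trans (lerD h2 h3))//.
  by rewrite -mulrDr; apply: ler_wpM2l => //; lra.
have [t St tt] := sup_adherent del10 hS.
have ttau : t <= tau by apply: sup_ubound => //; have [] := hS.
have [/andP[t0 tL] tadm] := St.
have htd : `|t - tau| < del1 by rewrite ler0_norm ?subr_le0//; move: tt; rewrite -/tau; lra.
have stepT t' : tau <= t' -> `|t' - tau| < del1 -> ac_admissible U h (A + e) t'.
  by move=> h1 h2; exact: (step t).
have [tauL'|] := ltP tau L.
  pose t' := Num.min L (tau + del1 / 2).
  have tt' : tau < t' by rewrite lt_min tauL' ltrDl divr_gt0.
  have : S t'.
    split; first by rewrite (le_trans tau0 (ltW tt')) ge_min lexx.
    apply: stepT; first exact: ltW.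
    rewrite ger0_norm ?subr_ge0 ?(ltW tt')//.
    have : t' <= tau + del1 / 2 by rewrite ge_min lexx orbT.
    by move: del10; lra.
  have [_ ub] := hS.
  by move=> /(ub_le_sup ub); rewrite leNgt tt'.
move=> Ltau; have tauE : tau = L by apply/eqP; rewrite eq_le tauL.
have : ac_admissible U h (A + e) L.
  by rewrite -tauE; apply: stepT => //; rewrite subrr normr0.
move=> [n [s [s' [s0 sd sm sh]]]].
have : \sum_(k < n) `|h (s' k) - h (s k)| < e2.
  apply: Hdel => //.
  rewrite -lte_fin; apply: (le_lt_trans sm); apply: le_lt_trans mUdel.
  by apply: le_measure; rewrite ?inE//; apply: measurableI => //; exact: measurable_itv.
have : e * L = e1 / 2 by rewrite /e divfK// gt_eqF.
rewrite /e2 => h1 h2; rewrite (le_trans sh)// mulrDl h1; lra.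
Qed.

End absolute_continuity.

(** * Taylor bounds on the function class *)

Section euclidean.
Context {R : realType} {d : nat}.
Local Notation V := 'rV[R]_d.
Implicit Types (x y z u v : V).

Lemma dotvC x y : dotv x y = dotv y x.
Proof. by apply: eq_bigr => i _; rewrite mulrC. Qed.

Lemma dotvDl x y z : dotv (x + y) z = dotv x z + dotv y z.
Proof. by rewrite /dotv -big_split; apply: eq_bigr => i _; rewrite mxE mulrDl. Qed.

Lemma dotvZl (l : R) x y : dotv (l *: x) y = l * dotv x y.
Proof. by rewrite /dotv mulr_sumr; apply: eq_bigr => i _; rewrite mxE mulrA. Qed.

Lemma dotvNl x y : dotv (- x) y = - dotv x y.
Proof. by rewrite -scaleN1r dotvZl mulN1r. Qed.

Lemma dotvBl x y z : dotv (x - y) z = dotv x z - dotv y z.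
Proof. by rewrite dotvDl dotvNl. Qed.

Lemma dotvDr x y z : dotv z (x + y) = dotv z x + dotv z y.
Proof. by rewrite dotvC dotvDl !(dotvC z). Qed.

Lemma dotvZr (l : R) x y : dotv x (l *: y) = l * dotv x y.
Proof. by rewrite dotvC dotvZl dotvC. Qed.

Lemma dotv0r x : dotv x 0 = 0.
Proof. by rewrite -(scale0r x) dotvZr mul0r. Qed.

Lemma dotvNr x y : dotv x (- y) = - dotv x y.
Proof. by rewrite dotvC dotvNl dotvC. Qed.

Lemma dotvBr x y z : dotv z (x - y) = dotv z x - dotv z y.
Proof. by rewrite dotvDr dotvNr. Qed.

Lemma dotvv_ge0 x : 0 <= dotv x x.
Proof. by apply: sumr_ge0 => i _; rewrite -expr2 sqr_ge0. Qed.

Lemma dotvv_ge_coord x i : x ord0 i ^+ 2 <= dotv x x.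
Proof.
rewrite /dotv (bigD1 i)//= -expr2 lerDl sumr_ge0// => j _.
by rewrite -expr2 sqr_ge0.
Qed.

Lemma dotvv_eq0 x : dotv x x = 0 -> x = 0.
Proof.
move=> x0; apply/rowP => i; rewrite mxE.
have := dotvv_ge_coord x i; rewrite x0 => xi.
by apply/eqP; rewrite -[_ == _]sqrf_eq0 eq_le xi sqr_ge0.
Qed.

Lemma enorm_ge0 x : 0 <= enorm x.
Proof. exact: sqrtr_ge0. Qed.

Lemma enorm_sqr x : enorm x ^+ 2 = dotv x x.
Proof. by rewrite sqr_sqrtr// dotvv_ge0. Qed.

Lemma enorm_eq0 x : enorm x = 0 -> x = 0.
Proof. by move=> x0; apply: dotvv_eq0; rewrite -enorm_sqr x0 expr0n. Qed.

Lemma enormZ (l : R) x : enorm (l *: x) = `|l| * enorm x.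
Proof.
by rewrite /enorm dotvZl dotvZr mulrA -expr2 sqrtrM ?sqr_ge0// sqrtr_sqr.
Qed.

Lemma coord_le_enorm x i : `|x ord0 i| <= enorm x.
Proof.
by rewrite -sqrtr_sqr /enorm ler_sqrt ?dotvv_ge0// dotvv_ge_coord.
Qed.

Lemma enorm_le_sqr x (r : R) : 0 <= r -> (enorm x <= r) = (dotv x x <= r ^+ 2).
Proof. by move=> r0; rewrite -enorm_sqr ler_sqr ?nnegrE ?enorm_ge0. Qed.

Lemma dotvv_le_coord x (r : R) : (forall i, `|x ord0 i| <= r) ->
  dotv x x <= d%:R * r ^+ 2.
Proof.
move=> xr; rewrite /dotv -[d in d%:R]card_ord mulr_natl -sumr_const.
apply: ler_sum => i _; rewrite -expr2 -real_normK ?num_real//.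
by rewrite lerXn2r ?nnegrE// (le_trans _ (xr i)).
Qed.

(** Cauchy-Schwarz, from the square of [dotv y y] times the component of [x] orthogonal to [y]. *)
Lemma dotv_sqr_le x y : dotv x y ^+ 2 <= dotv x x * dotv y y.
Proof.
have [y0|y0] := eqVneq (dotv y y) 0.
  have -> : y = 0 by exact: dotvv_eq0.
  by rewrite !dotv0r mulr0 expr0n.
have yy : 0 < dotv y y by rewrite lt_def y0 dotvv_ge0.
have := dotvv_ge0 (dotv y y *: x - dotv x y *: y).
rewrite !(dotvBl, dotvBr, dotvZl, dotvZr) (dotvC y x).
move=> H; rewrite -subr_ge0 -(pmulr_rge0 _ yy); apply: le_trans H _.
by rewrite le_eqVlt; apply/orP; left; apply/eqP; ring.
Qed.

Lemma dotv_le x y : `|dotv x y| <= enorm x * enorm y.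
Proof.
rewrite -ler_sqr ?nnegrE ?mulr_ge0 ?enorm_ge0// exprMn !enorm_sqr.
by rewrite real_normK ?num_real// dotv_sqr_le.
Qed.

Lemma interior_boxP (O : set V) x : interior O x <->
  exists2 r : R, 0 < r & forall z, (forall i, `|z ord0 i - x ord0 i| < r) -> O z.
Proof.
split.
  move=> /nbhs_ballP[r /= r0 rO]; exists r => // z zx; apply: rO; split => // i j.
  by rewrite (ord1 i) /ball/= distrC.
move=> [r r0 rO]; apply/nbhs_ballP; exists r => // z [_ zx]; apply: rO => i.
by have := zx ord0 i; rewrite /ball/= distrC.
Qed.

Lemma within_continuous_realP (O : set V) (f : V -> R) :
  {within O, continuous f} <->
  forall x, O x -> forall e : R, 0 < e -> exists2 r : R, 0 < r &
    forall z, O z -> (forall i, `|z ord0 i - x ord0 i| < r) -> `|f z - f x| < e.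
Proof.
rewrite subspace_continuousP; split => [cf x Ox e e0|cf x Ox].
  have /(@cvgrPdist_lt _ _ _ _)/(_ _ e0) := cf x Ox.
  move=> /nbhs_ballP[r /= r0 H]; exists r => // z Oz zx; rewrite distrC.
  apply: H => //; split => // i j.
  by rewrite (ord1 i) /ball/= distrC.
apply/cvgrPdist_lt => e e0; have [r r0 H] := cf x Ox e e0.
apply/nbhs_ballP; exists r => //= z [_ zx] Oz; rewrite distrC.
by apply: H => // i; have := zx ord0 i; rewrite /ball/= distrC.
Qed.

Lemma within_continuous_rowP (O : set V) (g : V -> V) :
  {within O, continuous g} ->
  forall x, O x -> forall e : R, 0 < e -> exists2 r : R, 0 < r &
    forall z, O z -> (forall i, `|z ord0 i - x ord0 i| < r) ->
    forall i, `|g z ord0 i - g x ord0 i| < e.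
Proof.
rewrite subspace_continuousP => cf x Ox e e0.
have := cf x Ox (ball (g x) e) (nbhsx_ballx _ _ e0).
move=> /nbhs_ballP[r /= r0 H]; exists r => // z Oz zx i; rewrite distrC.
have [_ ] : ball (g x) e (g z).
  apply: H => //; split => // k j.
  by rewrite (ord1 k) /ball/= distrC.
by move=> /(_ ord0 i).
Qed.

End euclidean.

(** * Taylor estimate in one variable *)

Section one_variable.
Context {R : realType}.

Lemma is_derive_eps (F : R -> R) (t D : R) :
  (forall e : R, 0 < e -> exists2 del : R, 0 < del & forall s, `|s - t| < del ->
     `|F s - F t - D * (s - t)| <= e * `|s - t|) -> is_derive t 1 F D.
Proof.
move=> H.
have cv : (fun h => h^-1 *: ((F \o shift t) (h *: 1) - F t)) @ 0^' --> D.
  apply/cvgrPdist_le => e e0; have [r r0 Hr] := H e e0.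
  apply/nbhs_ballP; exists r => //= h; rewrite /ball/= sub0r normrN => hr h0.
  have := Hr (h + t); rewrite addrK => /(_ hr).
  rewrite /= [h *: 1]mulr1 distrC => {}Hr.
  rewrite -(ler_pM2r (_ : 0 < `|h|)) ?normr_gt0// -normrM mulrBl.
  by rewrite [h^-1 *: _ * h]mulrC [h^-1 *: _]/GRing.scale/= mulrA mulfV// mul1r.
by apply: DeriveDef; [apply/cvg_ex; exists D|exact/cvg_lim].
Qed.

Lemma derivable_lip (F : R -> R) (A e : R) : derivable F 0 1 ->
  `|derive1 F 0| <= A -> 0 < e -> exists2 del : R, 0 < del &
  forall s, `|s| < del -> `|F s - F 0| <= (A + e) * `|s|.
Proof.
rewrite derive1E => dF DA e0.
have /(@cvgrPdist_le _ _ _ _)/(_ e e0) :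
  (fun h => h^-1 *: ((F \o shift 0) (h *: 1) - F 0)) @ 0^' --> 'D_1 F 0 by exact: dF.
move=> /nbhs_ballP[r /= r0 H]; exists r => // s sr.
have [->|s0] := eqVneq s 0; first by rewrite subrr normr0 mulr0.
have := H s; rewrite /ball/= sub0r normrN => /(_ sr s0).
rewrite [s *: 1]mulr1 addr0 => Hs.
have : `|s^-1 *: (F s - F 0)| <= A + e.
  rewrite -[X in `|X|](subrK ('D_1 F 0)) (le_trans (ler_normD _ _))// addrC.
  by rewrite lerD// distrC.
by rewrite normrZ normfV mulrC ler_pdivrMr ?normr_gt0.
Qed.

Lemma taylor_real (F H : R -> R) (L A : R) : 0 < L -> 0 <= A ->
  (forall t, 0 <= t <= L -> forall e : R, 0 < e -> exists2 del : R, 0 < del &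
     forall s, `|s - t| < del -> `|F s - F t - H t * (s - t)| <= e * `|s - t|) ->
  (forall t, 0 <= t <= L -> `|H t - H 0| <= A * t) ->
  `|F L - F 0 - H 0 * L| <= A / 2 * L ^+ 2.
Proof.
move=> L0 A0 dF HA.
have main (sg : R) : `|sg| = 1 -> sg * (F L - F 0 - H 0 * L) <= A / 2 * L ^+ 2.
  move=> sg1.
  (* The derivative of [phi] on [[0, L]] is at most zero by the bound on [H], so the mean value
     theorem gives [phi L <= phi 0]; the signs [sg = 1] and [sg = -1] give the two sides of the
     absolute value. *)
  pose phi s := sg * F s - sg * H 0 * s - A / 2 * s ^+ 2.
  pose dphi t := sg * H t - sg * H 0 - A * t.
  have dphiP t : 0 <= t <= L -> is_derive t 1 phi (dphi t).
    move=> tL; apply: is_derive_eps => e e0.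
    have e2 : 0 < e / 2 by rewrite divr_gt0.
    have [del del0 Hdel] := dF t tL _ e2.
    have A1 : 0 < A + 1 by rewrite ltr_wpDl.
    exists (Num.min del (e / (A + 1))); first by rewrite lt_min del0 divr_gt0.
    move=> s; rewrite lt_min => /andP[/Hdel h1 h2].
    have -> : phi s - phi t - dphi t * (s - t) =
      sg * (F s - F t - H t * (s - t)) - A / 2 * (s - t) ^+ 2.
      by rewrite /phi /dphi; field.
    rewrite (le_trans (ler_normB _ _))// normrM sg1 mul1r.
    have h3 : `|A / 2 * (s - t) ^+ 2| <= e / 2 * `|s - t|.
      rewrite normrM normrX expr2 mulrA ler_wpM2r//.
      rewrite ger0_norm ?divr_ge0//; move: h2; rewrite ltr_pdivlMr// mulrDr mulr1.
      by have := normr_ge0 (s - t); lra.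
    have -> : e = e / 2 + e / 2 by field.
    by rewrite mulrDl lerD.
  have [||c /itvP cL E] := @MVT_segment _ phi dphi 0 L (ltW L0).
  - by move=> x /itvP xL; apply: dphiP; rewrite !xL.
  - apply: derivable_within_continuous => x /itvP xL.
    by have [] := dphiP x; rewrite ?xL.
  - have : phi L - phi 0 <= 0.
      rewrite E subr0; apply: mulr_le0_ge0; last exact: ltW.
      have := HA c; rewrite !cL => /(_ isT); rewrite /dphi -mulrBr.
      have : sg * (H c - H 0) <= `|sg * (H c - H 0)| by exact: ler_norm.
      by rewrite normrM sg1 mul1r; lra.
    rewrite /phi expr0n/= !mulr0 !subr0; lra.
rewrite ler_norml; apply/andP; split.
  by have := main (-1); rewrite normrN normr1 => /(_ erefl); rewrite mulN1r; lra.
by have := main 1; rewrite normr1 mul1r => /(_ erefl).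
Qed.

End one_variable.

(** * Taylor estimate along good lines, and passage to the limit *)

Section taylor.
Context {R : realType} {d : nat}.
Local Notation V := 'rV[R]_d.
Local Notation mu := (@lebesgue_measure R).
Implicit Types (O : set V) (f : V -> R) (g : V -> V).

Definition taylor_bound O (A : R) f g := forall x y, O x -> O y ->
  `|f y - f x - dotv (g x) (y - x)| <= A / 2 * dotv (y - x) (y - x).

(** The condition negated in [second_dir_cond]: the interior points where it fails form a null
    set. *)
Definition good_point (p q : R) O f g (u x : V) :=
  loc_abs_cont_on (dir_deriv_line g u x) [set t | interior O (x + t *: u)]
  /\ derivable (dir_deriv_line g u x) 0 1
  /\ `|derive1 (dir_deriv_line g u x) 0 + p * dotv (g x) u + q * f x| <= 1.

Lemma dir_deriv_line_shift g (u y : V) (t s : R) :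
  dir_deriv_line g u (y + t *: u) s = dir_deriv_line g u y (t + s).
Proof. by rewrite /dir_deriv_line -addrA -scalerDl. Qed.

Lemma abs_cont_on_shift (h k : R -> R) (a b t : R) :
  (forall s, h s = k (t + s)) -> abs_cont_on h a b -> abs_cont_on k (t + a) (t + b).
Proof.
move=> hk H e /H[del del0 {}H]; exists del => // n s s' sab sd sdel.
have kh r : k r = h (r - t) by rewrite hk addrC subrK.
under eq_bigr do rewrite !kh.
apply: (H n (fun k => s k - t) (fun k => s' k - t)).
- by move=> j /sab[/andP[? ?] ?]; split; [apply/andP; split|]; lra.
- by move=> j l jn ln jl; have [?|?] := sd j l jn ln jl; [left|right]; lra.
- apply: le_lt_trans sdel; apply: ler_sum => i _; lra.
Qed.

Lemma abs_cont_onW (h : R -> R) (a b b' : R) : b' <= b ->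
  abs_cont_on h a b -> abs_cont_on h a b'.
Proof.
move=> bb H e /H[del del0 {}H]; exists del => // n s s' sab.
apply: H => k /sab[? h1]; split => //; exact: le_trans h1 bb.
Qed.

Lemma enorm1_coord (u : V) : enorm u = 1 -> forall i, `|u ord0 i| <= 1.
Proof. by move=> <- i; exact: coord_le_enorm. Qed.

(** At a good point the derivative of the directional derivative is at most 1 plus the lower order
    terms, that is at most [A]. By [abs_cont_lip] the directional derivative changes by at most
    [A * t], which is what [taylor_real] needs. *)
Lemma taylor_good_line (p q M0 M1 L : R) O f g (u y : V) :
  C1_on O f g -> enorm u = 1 -> 0 < L ->
  (forall t, 0 <= t <= L -> interior O (y + t *: u)) ->
  (forall x, O x -> `|f x| <= M0) -> (forall x, O x -> enorm (g x) <= M1) ->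
  {ae mu, forall t, 0 <= t <= L -> good_point p q O f g u (y + t *: u)} ->
  `|f (y + L *: u) - f y - dotv (g y) u * L| <=
    (1 + `|p| * M1 + `|q| * M0) / 2 * L ^+ 2.
Proof.
move=> [_ dfO] u1 L0 yO fM gM good.
set A := 1 + _ + _.
have intO x : interior O x -> O x by apply: interior_subset.
have Oy0 : O y by apply: intO; rewrite -[y]addr0 -(scale0r u); apply: yO; rewrite lexx ltW.
have M00 : 0 <= M0 by rewrite (le_trans _ (fM _ Oy0)).
have M10 : 0 <= M1 by rewrite (le_trans _ (gM _ Oy0)) ?enorm_ge0.
have A0 : 0 <= A by rewrite !addr_ge0// mulr_ge0.
pose F t := f (y + t *: u); pose H := dir_deriv_line g u y.
have HACL : abs_cont_on H 0 L.
  (* Local absolute continuity concerns the whole line, so a single good point [t] on the segment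
     provides it; the parameter is then shifted by [t]. *)
  have [t /andP[t0 tL] gt] := ae_exists_itv L0 good.
  have [] := gt _; first by rewrite (ltW t0) (ltW tL).
  move=> lac _; have -> : 0 = t + (- t) by rewrite subrr.
  rewrite -[L](subrK t) [L - t + t]addrC.
  apply: abs_cont_on_shift (fun s => dir_deriv_line_shift g u y t s) _.
  apply: lac; first by move: t0 tL; lra.
  move=> s; rewrite /= in_itv/= => /andP[s0 sL].
  by rewrite -addrA -scalerDl; apply: yO; apply/andP; split; lra.
have -> : f y = F 0 by rewrite /F scale0r addr0.
have -> : dotv (g y) u = H 0 by rewrite /H /dir_deriv_line scale0r addr0.
apply: taylor_real => //.
- move=> t tL e e0.
  have /interior_boxP[r r0 rO] := yO t tL.
  have [del del0 Hdel] := dfO _ (intO _ (yO t tL)) e e0.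
  exists (Num.min r del); first by rewrite lt_min r0.
  move=> s; rewrite lt_min => /andP[sr sdel].
  have E : y + s *: u - (y + t *: u) = (s - t) *: u.
    by rewrite scalerBl opprD addrACA subrr add0r.
  have := Hdel (y + s *: u); rewrite E enormZ u1 mulr1 => /(_ _ sdel).
  rewrite dotvZr mulrC; apply; apply: rO => i.
  apply: le_lt_trans sr; rewrite !mxE opprD addrACA subrr add0r -mulrBl normrM.
  by rewrite ler_piMr// enorm1_coord.
- move=> t /andP[]; rewrite le_eqVlt => /predU1P[<- _|t0 tL].
    by rewrite subrr normr0 mulr0.
  apply: abs_cont_lip => //; first exact: abs_cont_onW HACL.
  apply: (@filterS _ _ (ae_filter_ringOfSetsType mu)) good => s gs /andP[s0 st] e e0.
  have sL : 0 <= s <= L by rewrite s0 (le_trans st tL).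
  have [_ [der Ds]] := gs sL.
  have Os := intO _ (yO s sL).
  have DA : `|derive1 (dir_deriv_line g u (y + s *: u)) 0| <= A.
    set D := derive1 _ _ in Ds *.
    have h1 : `|p * dotv (g (y + s *: u)) u| <= `|p| * M1.
      rewrite normrM ler_wpM2l// (le_trans (dotv_le _ _))// u1 mulr1.
      exact: gM.
    have h2 : `|q * f (y + s *: u)| <= `|q| * M0.
      by rewrite normrM ler_wpM2l// fM.
    move: Ds h1 h2; rewrite /A !ler_norml => /andP[? ?] /andP[? ?] /andP[? ?].
    by apply/andP; split; lra.
  have [del del0 Hdel] := derivable_lip der DA e0.
  exists del => // r /Hdel; rewrite !dir_deriv_line_shift addr0.
  by rewrite [s + (r - s)]addrC subrK.
Qed.

Lemma cvg_sum_ord (T : Type) (F : set_system T) (FF : Filter F) n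
  (h : 'I_n -> T -> R) (l : 'I_n -> R) :
  (forall i, h i @ F --> l i) -> (fun x => \sum_i h i x) @ F --> \sum_i l i.
Proof.
move=> H; elim: n h l H => [|n IH] h l H.
  by rewrite big_ord0; under eq_fun do rewrite big_ord0; exact: cvg_cst.
rewrite big_ord_recr/=; under eq_fun do rewrite big_ord_recr/=.
by apply: cvgD; [exact: IH|exact: H].
Qed.

Lemma taylor_bound_closed (A : R) O f g (x y : V) :
  {within O, continuous f} -> {within O, continuous g} -> O x -> O y ->
  (forall e : R, 0 < e -> exists x' y' : V, [/\ O x', O y',
     (forall i, `|x' ord0 i - x ord0 i| < e), (forall i, `|y' ord0 i - y ord0 i| < e) &
     `|f y' - f x' - dotv (g x') (y' - x')| <= A / 2 * dotv (y' - x') (y' - x')]) ->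
  `|f y - f x - dotv (g x) (y - x)| <= A / 2 * dotv (y - x) (y - x).
Proof.
move=> /within_continuous_realP cf /within_continuous_rowP cg Ox Oy H.
have [xy Hxy] : {xy : nat -> V * V & forall n, [/\ O (xy n).1, O (xy n).2,
     (forall i, `|(xy n).1 ord0 i - x ord0 i| < n.+1%:R^-1),
     (forall i, `|(xy n).2 ord0 i - y ord0 i| < n.+1%:R^-1) &
     `|f (xy n).2 - f (xy n).1 - dotv (g (xy n).1) ((xy n).2 - (xy n).1)| <=
       A / 2 * dotv ((xy n).2 - (xy n).1) ((xy n).2 - (xy n).1)]}.
  apply: (@choice _ _ (fun n (z : V * V) => [/\ O z.1, O z.2,
     (forall i, `|z.1 ord0 i - x ord0 i| < n.+1%:R^-1),
     (forall i, `|z.2 ord0 i - y ord0 i| < n.+1%:R^-1) &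
     `|f z.2 - f z.1 - dotv (g z.1) (z.2 - z.1)| <= A / 2 * dotv (z.2 - z.1) (z.2 - z.1)])).
  move=> n; have [|x' [y' [? ? ? ? ?]]] := H n.+1%:R^-1; first by [].
  by exists (x', y').
have small (e : R) : 0 < e -> \forall n \near \oo, n.+1%:R^-1 < e.
  by move=> e0; exact: (near_infty_natSinv_lt (PosNum e0)).
have cx i : (fun n => (xy n).1 ord0 i) @ \oo --> x ord0 i.
  apply/cvgrPdist_lt => e e0; near=> n; rewrite distrC.
  have [_ _ + _ _] := Hxy n => /(_ i) /lt_trans; apply; near: n; exact: small.
have cy i : (fun n => (xy n).2 ord0 i) @ \oo --> y ord0 i.
  apply/cvgrPdist_lt => e e0; near=> n; rewrite distrC.
  have [_ _ _ + _] := Hxy n => /(_ i) /lt_trans; apply; near: n; exact: small.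
have cfx : (fun n => f (xy n).1) @ \oo --> f x.
  apply/cvgrPdist_lt => e e0; have [r r0 Hr] := cf x Ox e e0.
  near=> n; rewrite distrC; have [On _ xn _ _] := Hxy n; apply: Hr => // i.
  apply: lt_trans (xn i) _; near: n; exact: small.
have cfy : (fun n => f (xy n).2) @ \oo --> f y.
  apply/cvgrPdist_lt => e e0; have [r r0 Hr] := cf y Oy e e0.
  near=> n; rewrite distrC; have [_ On _ yn _] := Hxy n; apply: Hr => // i.
  apply: lt_trans (yn i) _; near: n; exact: small.
have cgx i : (fun n => g (xy n).1 ord0 i) @ \oo --> g x ord0 i.
  apply/cvgrPdist_lt => e e0; have [r r0 Hr] := cg x Ox e e0.
  near=> n; rewrite distrC; have [On _ xn _ _] := Hxy n; apply: Hr => // j.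
  apply: lt_trans (xn j) _; near: n; exact: small.
have cd i : (fun n => ((xy n).2 - (xy n).1) ord0 i) @ \oo --> (y - x) ord0 i.
  under eq_fun do rewrite !mxE; rewrite !mxE; exact: cvgB.
have cl : (fun n => `|f (xy n).2 - f (xy n).1 -
    dotv (g (xy n).1) ((xy n).2 - (xy n).1)|) @ \oo -->
    `|f y - f x - dotv (g x) (y - x)|.
  apply: cvg_norm; apply: cvgB; first exact: cvgB.
  by apply: cvg_sum_ord => i; exact: cvgM.
have cr : (fun n => A / 2 * dotv ((xy n).2 - (xy n).1) ((xy n).2 - (xy n).1)) @ \oo -->
    A / 2 * dotv (y - x) (y - x).
  apply: cvgM; first exact: cvg_cst.
  by apply: cvg_sum_ord => i; exact: cvgM.
apply: (ler_cvg_to cl cr); apply: nearW => n.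
by have [] := Hxy n.
Unshelve. all: by end_near.
Qed.

End taylor.

(** * Taylor estimate for the whole class *)

Section WPD_taylor.
Context {R : realType} {d : nat}.
Local Notation V := 'rV[R]_d.
Local Notation mu := (@lebesgue_measure R).
Implicit Types (O : set V) (f : V -> R) (g : V -> V).

(** The crude factor [d.+1] in place of the square root of [d] makes the inequality strict, also for
    [d = 0]. *)
Lemma enorm_lt_coord (x : V) (r : R) : 0 < r -> (forall i, `|x ord0 i| <= r) ->
  enorm x < d.+1%:R * r.
Proof.
move=> r0 xr; rewrite -ltr_sqr ?nnegrE ?enorm_ge0 ?mulr_ge0 ?(ltW r0)//.
rewrite enorm_sqr; apply: le_lt_trans (dotvv_le_coord xr) _.
rewrite exprMn ltr_pM2r ?exprn_gt0//.
by rewrite expr2 -natrM ltr_nat (leq_trans (ltnSn d))// leq_pmulr.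
Qed.

Lemma C1_within_continuous O f g : C1_on O f g -> {within O, continuous f}.
Proof.
move=> [_ dfO]; apply/within_continuous_realP => x Ox e e0.
have [del del0 H] := dfO x Ox 1 ltr01.
set G := enorm (g x) + 1.
have G0 : 0 < G by rewrite ltr_wpDl// enorm_ge0.
have m0 : 0 < Num.min del (e / G) by rewrite lt_min del0 divr_gt0.
exists (Num.min del (e / G) / d.+1%:R); first by rewrite divr_gt0.
move=> z Oz zx.
have : enorm (z - x) < d.+1%:R * (Num.min del (e / G) / d.+1%:R).
  apply: enorm_lt_coord; first by rewrite divr_gt0.
  by move=> i; rewrite !mxE ltW.
rewrite mulrC divfK ?pnatr_eq0// lt_min => /andP[zdel zG].
have := H z Oz zdel; rewrite mul1r => h1.
have h2 := dotv_le (g x) (z - x).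
have : `|f z - f x| <= G * enorm (z - x).
  rewrite -[f z - f x](subrK (dotv (g x) (z - x))) (le_trans (ler_normD _ _))//.
  by rewrite /G mulrDl mul1r addrC lerD.
by move=> /le_lt_trans; apply; rewrite mulrC -ltr_pdivlMr.
Qed.

(** The segment from [x] to [y] may lie on the boundary or on a bad line. It is contracted towards
    an interior point [c], then translated slightly onto a line almost all of whose points are good;
    the estimate for it passes to the limit by [taylor_bound_closed]. *)
Lemma WPD_taylor (p q M0 M1 : R) O fg : convex_body O -> WPD p q O fg ->
  (forall x, O x -> `|fg.1 x| <= M0) -> (forall x, O x -> enorm (fg.2 x) <= M1) ->
  taylor_bound O (1 + `|p| * M1 + `|q| * M0) fg.1 fg.2.
Proof.
case: fg => f g /= [cvxO _ [c /interior_boxP[rho rho0 cO]]] [/= c1 sdc] fM gM x y Ox Oy.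
have [->|xy] := eqVneq y x.
  by rewrite !subrr !dotv0r subr0 normr0 mulr0.
have nxy : enorm (y - x) != 0 by apply: contra_neq xy => /enorm_eq0/subr0_eq.
have nxy0 : 0 < enorm (y - x) by rewrite lt_def nxy enorm_ge0.
have [cg _] := c1.
apply: (taylor_bound_closed (C1_within_continuous c1) cg Ox Oy) => e e0.
pose B := enorm (c - x) + enorm (c - y) + 1.
have B0 : 0 < B by rewrite ltr_wpDl// addr_ge0// enorm_ge0.
(* Contraction by [del] moves both endpoints by at most [e / 2]; the translation by less than [e']
   uses the other half of [e]. *)
pose del := Num.min (2^-1) (e / (2 * B)).
have del0 : 0 < del by rewrite lt_min invr_gt0 ltr0n/= divr_gt0// mulr_gt0.
have del1 : del <= 2^-1 by rewrite ge_min lexx.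
have dele : del * B <= e / 2.
  have : del <= e / (2 * B) by rewrite ge_min lexx orbT.
  move=> /(ler_wpM2r (ltW B0)) /le_trans; apply.
  by rewrite invfM mulrA divfK// gt_eqF.
pose L := (1 - del) * enorm (y - x).
have del1' : 0 < 1 - del by move: del1; lra.
have L0 : 0 < L by rewrite mulr_gt0.
pose u := (enorm (y - x))^-1 *: (y - x).
have u1 : enorm u = 1 by rewrite enormZ ger0_norm ?invr_ge0 ?enorm_ge0// mulVf.
pose xd := x + del *: (c - x).
(* The contracted segment has a neighbourhood of radius [del * rho] in [O]: half of it is for the
   translation, half leaves the translated segment in the interior. *)
pose e' := Num.min (e / 2) (del * rho / 2).
have e'0 : 0 < e' by rewrite lt_min !divr_gt0// mulr_gt0.
have [x' x'x aex] := null_ae_direction xd L0 e'0 (enorm1_coord u1) (sdc u u1).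
have tuE t : t *: u = ((1 - del) * (t / L)) *: (y - x).
  by rewrite /u scalerA; congr (_ *: _); rewrite /L; field; rewrite nxy gt_eqF.
have intx' t : 0 <= t <= L -> interior O (x' + t *: u).
  move=> /andP[t0 tL]; apply/interior_boxP.
  exists (del * rho / 2); first by rewrite divr_gt0// mulr_gt0.
  move=> z zx; pose th := t / L.
  have th01 : 0 <= th <= 1.
    apply/andP; split; first by rewrite divr_ge0// ltW.
    by rewrite ler_pdivrMr ?mul1r.
  pose w := z - (xd + t *: u).
  (* [z] is a convex combination of a point of the original segment and a point within [rho] of
     [c]. *)
  have -> : z = (1 - del) *: ((1 - th) *: x + th *: y) + del *: (c + del^-1 *: w).
    apply/rowP => i; rewrite /w tuE -/th !mxE; field; by rewrite gt_eqF.
  have del01 : 0 <= del <= 1 by rewrite (ltW del0)/=; move: del1; lra.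
  apply: (cvxO _ _ del (cvxO x y th Ox Oy th01) _ del01).
  apply: (cO) => i.
  have -> : (c + del^-1 *: w) ord0 i - c ord0 i = del^-1 * w ord0 i.
    by rewrite mxE [X in _ + X - _]mxE; ring.
  rewrite normrM gtr0_norm ?invr_gt0// ltr_pdivrMl//.
  have := zx i; have := x'x i; rewrite lt_min => /andP[_].
  rewrite !mxE !ltr_norml => /andP[? ?] /andP[? ?]; apply/andP; split; lra.
have intO z : interior O z -> O z by apply: interior_subset.
have Ox' : O x' by apply: intO; rewrite -[x']addr0 -(scale0r u); apply: intx'; rewrite lexx ltW.
exists x', (x' + L *: u); split => //.
- by apply/intO/intx'; rewrite lexx ltW.
- move=> i; have := x'x i; rewrite lt_min => /andP[h1 _].
  have h2 : `|del * (c - x) ord0 i| <= e / 2.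
    rewrite normrM gtr0_norm//; apply: (le_trans _ dele).
    apply: ler_wpM2l; first exact: ltW.
    apply: (le_trans (coord_le_enorm _ _)).
    by rewrite /B; have := enorm_ge0 (c - y); lra.
  move: h1 h2; rewrite !mxE !ltr_norml !ler_norml => /andP[? ?] /andP[? ?].
  by apply/andP; split; lra.
- move=> i; have := x'x i; rewrite lt_min => /andP[h1 _].
  have h2 : `|del * (c - y) ord0 i| <= e / 2.
    rewrite normrM gtr0_norm//; apply: (le_trans _ dele).
    apply: ler_wpM2l; first exact: ltW.
    apply: (le_trans (coord_le_enorm _ _)).
    by rewrite /B; have := enorm_ge0 (c - x); lra.
  move: h1 h2; rewrite tuE divff ?gt_eqF// mulr1 !mxE !ltr_norml !ler_norml.
  by move=> /andP[? ?] /andP[? ?]; apply/andP; split; lra.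
- have -> : x' + L *: u - x' = L *: u by rewrite addrAC subrr add0r.
  rewrite -[X in _ <= _ * X]enorm_sqr enormZ u1 mulr1 real_normK ?num_real//.
  rewrite (dotvZr L) [L * _]mulrC.
  apply: (taylor_good_line c1 u1 L0 intx' fM gM).
  apply: (@filterS _ _ (ae_filter_ringOfSetsType mu)) aex => t nN tL.
  by apply: contrapT => ngood; apply: (nN tL); split => //; exact: intx'.
Qed.

End WPD_taylor.

(** * Functions with zero information, and the recovery algorithm *)

Section zero_information.
Context {R : realType} {d : nat}.
Local Notation V := 'rV[R]_d.
Implicit Types (O : set V) (f : V -> R) (g : V -> V) (x y z : V).

Lemma enorm_triangle x y : enorm (x + y) <= enorm x + enorm y.
Proof.
rewrite -ler_sqr ?nnegrE ?addr_ge0 ?enorm_ge0// sqrrD !enorm_sqr.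
rewrite dotvDl !dotvDr (dotvC y x).
by have := ler_norm (dotv x y); have := dotv_le x y; lra.
Qed.

Lemma enorm_dist x y : `|enorm x - enorm y| <= enorm (x - y).
Proof.
have h1 := enorm_triangle (x - y) y; rewrite subrK in h1.
have h2 := enorm_triangle (y - x) x; rewrite subrK in h2.
have : enorm (y - x) = enorm (x - y) by rewrite -opprB -scaleN1r enormZ normrN1 mul1r.
by rewrite ler_norml => E; apply/andP; split; lra.
Qed.

Lemma compact_coord_bound O : compact O ->
  exists2 M : R, 0 < M & forall x, O x -> forall i, `|x ord0 i| <= M.
Proof.
move=> /compact_bounded[M [_ HM]]; exists (`|M| + 2); first by rewrite ltr_wpDl.
move=> x Ox i; apply: ltW.
have : ball (0 : V) (`|M| + 2) x.
  rewrite mx_norm_ball /ball_/= sub0r normrN.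
  apply: le_lt_trans (HM (`|M| + 1) _ x Ox) _; last by rewrite ltrD2l ltr1n.
  by rewrite (le_lt_trans (ler_norm M))// ltrDl.
by move=> [_ /(_ ord0 i)]; rewrite /ball/= mxE sub0r normrN.
Qed.

Lemma within_continuous_norm O f : {within O, continuous f} ->
  {within O, continuous (fun x => `|f x|)}.
Proof.
move=> /within_continuous_realP cf; apply/within_continuous_realP => x Ox e e0.
have [r r0 H] := cf x Ox e e0; exists r => // z Oz zx.
by apply: le_lt_trans (ler_dist_dist _ _) _; exact: H.
Qed.

Lemma within_continuous_enorm O g : {within O, continuous g} ->
  {within O, continuous (fun x => enorm (g x))}.
Proof.
move=> /within_continuous_rowP cg; apply/within_continuous_realP => x Ox e e0.
have [|r r0 H] := cg x Ox (e / d.+1%:R); first by rewrite divr_gt0.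
exists r => // z Oz zx; apply: le_lt_trans (enorm_dist _ _) _.
have : enorm (g z - g x) < d.+1%:R * (e / d.+1%:R).
  apply: enorm_lt_coord; first by rewrite divr_gt0.
  by move=> i; rewrite !mxE ltW// H.
by rewrite mulrC divfK ?pnatr_eq0.
Qed.

Lemma taylor_boundN O (A : R) f g : taylor_bound O A f g ->
  taylor_bound O A (fun x => - f x) (fun x => - g x).
Proof.
move=> T x y Ox Oy; rewrite dotvNl -normrN.
by have := T x y Ox Oy; congr (`|_| <= _); ring.
Qed.

Lemma taylor_max_grad0 O (A : R) f g x : 0 <= A -> taylor_bound O A f g ->
  interior O x -> (forall z, O z -> f z <= f x) -> g x = 0.
Proof.
move=> A0 T /[dup] intx /interior_boxP[r r0 rO] fmax.
set G := g x; apply: dotvv_eq0.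
have G1 : 0 < enorm G + 1 by rewrite ltr_wpDl// enorm_ge0.
have A1 : 0 < A + 1 by rewrite ltr_wpDl.
(* The first bound keeps [x + t *: G] in [O]; the second gives [A * t < 1], so that a nonzero [G]
   would make [f] increase along it. *)
pose t := Num.min (r / (enorm G + 1)) ((A + 1)^-1).
have t0 : 0 < t by rewrite lt_min divr_gt0//= invr_gt0.
have tA : A * t < 1.
  have : t <= (A + 1)^-1 by rewrite ge_min lexx orbT.
  move=> /(ler_wpM2l A0) /le_lt_trans; apply.
  by rewrite ltr_pdivrMr// mul1r ltrDl.
have Oz : O (x + t *: G).
  apply: rO => i; rewrite !mxE addrAC subrr add0r normrM gtr0_norm//.
  have : t <= r / (enorm G + 1) by rewrite ge_min lexx.
  rewrite ler_pdivlMr// => /(lt_le_trans _); apply.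
  by rewrite ltr_pM2l// (le_lt_trans (coord_le_enorm G i))// ltrDl.
have Ox : O x by apply: interior_subset.
have := T x _ Ox Oz; have := fmax _ Oz.
have -> : x + t *: G - x = t *: G by rewrite addrAC subrr add0r.
rewrite -/G !dotvZr dotvZl ler_norml => h1 /andP[h2 _].
have gg := dotvv_ge0 G.
apply/eqP; rewrite eq_le gg andbT.
have h3 : dotv G G * t * (1 - A / 2 * t) <= 0 by move: h1 h2; lra.
rewrite leNgt; apply/negP => gg0.
by move: h3; rewrite leNgt mulr_gt0 ?mulr_gt0//; move: tA; lra.
Qed.

(** Distances are squared, so [h ^+ 2 / 2] stands for the distance [h / sqrt 2]. This closer node is
    asked for where the point need not be interior and a maximum need not be critical. *)
Definition node_net O (xi : seq V) (h : R) := forall x, O x ->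
  (interior O x /\ exists2 y, y \in xi & dotv (x - y) (x - y) <= h ^+ 2) \/
  exists2 y, y \in xi & dotv (x - y) (x - y) <= h ^+ 2 / 2.

(** Both alternatives of [node_net] at a maximum point of [|f|] give the same bound: a single
    expansion from a node at squared distance [h ^+ 2 / 2], or two expansions over half the distance
    when the maximum is interior. *)
Lemma zero_info_max O (A h : R) f g (xi : seq V) : convex_body O -> 0 <= A ->
  {within O, continuous f} -> taylor_bound O A f g ->
  (forall y, y \in xi -> [/\ O y, f y = 0 & g y = 0]) -> node_net O xi h ->
  forall x, O x -> `|f x| <= A * h ^+ 2 / 4.
Proof.
move=> [cvx cO [c0 intc0]] A0 cf T xi0 net x Ox.
have [c cOc cmax] : exists2 c, c \in O & forall t, t \in O -> `|f t| <= `|f c|.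
  by apply: EVT_max_rV => //; [exists c0; exact: interior_subset|
    exact: within_continuous_norm].
rewrite inE in cOc.
apply: le_trans (cmax x _) _; first by rewrite inE.
have [[intc [y yxi cy]]|[y yxi cy]] := net c cOc; have [Oy fy gy] := xi0 y yxi; last first.
  have := T y c Oy cOc; rewrite fy gy subr0 dotvC dotv0r subr0 => /le_trans; apply.
  by have := ler_wpM2l A0 cy; lra.
have gc : g c = 0.
  have [fc|fc] := leP 0 (f c).
    apply: (taylor_max_grad0 A0 T intc) => z Oz.
    by rewrite (le_trans (ler_norm _))// -(ger0_norm fc) cmax ?inE.
  apply/eqP; rewrite -oppr_eq0; apply/eqP.
  apply: (taylor_max_grad0 A0 (taylor_boundN T) intc) => z Oz.
  rewrite -(ltr0_norm fc) (le_trans _ (cmax z _)) ?inE//.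
  by rewrite -normrN ler_norm.
(* Both endpoints of the segment from the node [y] to the maximum point [c] are
   critical, so Taylor's formula can be used from each of them up to the midpoint. *)
pose m := (1 - 2^-1) *: y + 2^-1 *: c.
have Om : O m by apply: cvx => //; rewrite invr_ge0 ler0n/= invf_le1 ?ler1n ?ltr0n.
have my : m - y = 2^-1 *: (c - y) by apply/rowP => i; rewrite !mxE; field.
have mc : m - c = (- 2^-1) *: (c - y) by apply/rowP => i; rewrite !mxE; field.
have := T y m Oy Om; have := T c m cOc Om.
rewrite fy gy gc my mc !dotvZr !dotvZl !(dotvC 0) !dotv0r !mulr0 !subr0 !ler_norml.
move=> /andP[h1 h2] /andP[h3 h4].
by have cy' := ler_wpM2l A0 cy; apply/andP; split; lra.
Qed.

(** The Taylor constant [A] involves the suprema of [f] and of its gradient, which are themselves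
    [O(A * h)]; solving for [A] gives [A <= (1 - kap * h)^-1]. The second estimate is a modulus of
    continuity common to all such functions, from which the recovery algorithm gets continuous
    outputs. *)
Lemma zero_info_estimates O (p q : R) : convex_body O ->
  exists kap C : R, [/\ 0 <= kap, 0 <= C &
  forall (h : R) (xi : seq V) fg, 0 < h <= 1 -> kap * h < 1 -> WPD p q O fg ->
  (forall y, y \in xi -> [/\ O y, fg.1 y = 0 & fg.2 y = 0]) -> node_net O xi h ->
  (forall x, O x -> `|fg.1 x| <= (1 - kap * h)^-1 * h ^+ 2 / 4) /\
  (forall x y, O x -> O y -> `|fg.1 y - fg.1 x| <=
     (1 - kap * h)^-1 * (C * enorm (y - x) + dotv (y - x) (y - x)))].
Proof.
move=> bO; have [cvx cO [c intc]] := bO.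
have /interior_boxP[rho rho0 rhoO] := intc.
have [M M0 OM] := compact_coord_bound cO.
pose D := d%:R * (2 * M) ^+ 2.
have D0 : 0 <= D by rewrite mulr_ge0// sqr_ge0.
have OD x z : O x -> O z -> dotv (z - x) (z - x) <= D.
  move=> Ox Oz; apply: dotvv_le_coord => i; rewrite !mxE.
  by rewrite (le_trans (ler_normB _ _))// (_ : 2 * M = M + M) ?lerD ?OM//; ring.
have Oc : O c by apply: interior_subset.
pose r2 := rho / 2; have r20 : 0 < r2 by rewrite divr_gt0.
pose C := (2 + D) / r2.
have C0 : 0 <= C by rewrite /C divr_ge0 ?addr_ge0// ltW.
exists (`|p| * C + `|q|), C; split; [by apply: addr_ge0 => //; exact: mulr_ge0|by []|].
move=> h xi [f g] /andP[h0 h1] kh W xi0 net; rewrite /= in xi0 *.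
set kap := _ + _ in kh *.
have [c1 _] := W; have [cg _] := c1; rewrite /= in c1 cg.
have cf := C1_within_continuous c1.
have On0 : O !=set0 by exists c.
have [x0 Ox0 f0max] := EVT_max_rV On0 cO (within_continuous_norm cf).
have [x1 Ox1 g1max] := EVT_max_rV On0 cO (within_continuous_enorm cg).
rewrite inE in Ox0; rewrite inE in Ox1.
pose m0 := `|f x0|; pose m1 := enorm (g x1).
have fm x : O x -> `|f x| <= m0 by move=> Ox; apply: f0max; rewrite inE.
have gm x : O x -> enorm (g x) <= m1 by move=> Ox; apply: g1max; rewrite inE.
pose A := 1 + `|p| * m1 + `|q| * m0.
have T : taylor_bound O A f g := WPD_taylor bO W fm gm.
have m0_ge0 : 0 <= m0 by exact: normr_ge0.
have m1_ge0 : 0 <= m1 by exact: enorm_ge0.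
have A0 : 0 <= A by apply: addr_ge0; [apply: addr_ge0 => //|]; exact: mulr_ge0.
have m0A : m0 <= A / 2 * h ^+ 2.
  have [y yxi cy] : exists2 y, y \in xi & dotv (x0 - y) (x0 - y) <= h ^+ 2.
    case: (net x0 Ox0) => [[_ [y yxi cy]]|[y yxi cy]]; exists y => //.
    by have := sqr_ge0 h; lra.
  have [Oy fy gy] := xi0 y yxi.
  have := T y x0 Oy Ox0; rewrite fy gy subr0 dotvC dotv0r subr0 => /le_trans; apply.
  by rewrite ler_wpM2l// divr_ge0.
(* An interpolation inequality: a step of relative length [h] towards [z] bounds the slope by the
   oscillation of [f], of order [A * h ^+ 2], divided by [h], plus a Taylor remainder of order
   [A * h]. *)
have m1A : m1 <= C * A * h.
  have dir z : O z -> `|dotv (g x1) (z - x1)| <= A * h * (1 + D / 2).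
    move=> Oz; pose zh := (1 - h) *: x1 + h *: z.
    have Ozh : O zh by apply: cvx => //; rewrite h1 ltW.
    have E : zh - x1 = h *: (z - x1) by apply/rowP => i; rewrite !mxE; ring.
    have := T x1 zh Ox1 Ozh; rewrite E !dotvZr dotvZl => t1.
    have t2 := fm _ Ozh; have t3 := fm _ Ox1.
    have t4 : h * (h * dotv (z - x1) (z - x1)) <= h ^+ 2 * D.
      by rewrite mulrA -expr2 ler_wpM2l ?sqr_ge0// OD.
    have t5 : A / 2 * (h * (h * dotv (z - x1) (z - x1))) <= A / 2 * (h ^+ 2 * D).
      by rewrite ler_wpM2l// divr_ge0.
    have : `|h * dotv (g x1) (z - x1)| <= h * (A * h * (1 + D / 2)).
      move: t1 t2 t3; rewrite !ler_norml => /andP[? ?] /andP[? ?] /andP[? ?].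
      by apply/andP; split; lra.
    by rewrite normrM gtr0_norm// ler_pM2l.
  have CA : 0 <= C * A by exact: mulr_ge0.
  have CAh : 0 <= C * A * h by apply: mulr_ge0 => //; exact: ltW.
  have [m10|m10] := eqVneq m1 0; first by rewrite m10.
  have m1p : 0 < m1 by rewrite lt_def m10 enorm_ge0.
  pose v := m1^-1 *: g x1.
  (* The directions from [x1] to [c] and to [c + r2 *: v] differ by [r2] times the unit vector along
     [g x1], so the two bounds [dir] control [r2 * m1]; this is where [C] comes from. *)
  have Ob : O (c + r2 *: v).
    apply: rhoO => i.
    have -> : (c + r2 *: v) ord0 i - c ord0 i = r2 / m1 * g x1 ord0 i.
      by rewrite !mxE; ring.
    rewrite normrM gtr0_norm ?divr_gt0//.
    rewrite (@le_lt_trans _ _ (r2 / m1 * m1))//.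
      by apply: ler_wpM2l; [rewrite divr_ge0 ?ltW|exact: coord_le_enorm].
    by rewrite divfK// /r2; move: rho0; lra.
  have E : dotv (g x1) (c + r2 *: v - x1) - dotv (g x1) (c - x1) = r2 * m1.
    rewrite -dotvBr (_ : _ - _ = (r2 / m1) *: g x1); last first.
      by apply/rowP => i; rewrite !mxE; ring.
    by rewrite dotvZr -enorm_sqr -/m1; field.
  have := dir _ Ob; have := dir _ Oc; rewrite !ler_norml => /andP[? ?] /andP[? ?].
  rewrite -(ler_pM2l r20) (_ : r2 * (C * A * h) = (2 + D) * A * h); first by lra.
  by rewrite /C; field; rewrite gt_eqF.
(* Both bounds are inserted into the definition of [A]; [h <= 1] turns [h ^+ 2] into [h]. *)
have AK : A * (1 - kap * h) <= 1.
  have h2 : h ^+ 2 <= h by rewrite expr2 ler_piMr// ltW.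
  have e1 : `|p| * m1 <= `|p| * (C * A * h) by rewrite ler_wpM2l.
  have e2 : `|q| * m0 <= `|q| * (A / 2 * h ^+ 2) by rewrite ler_wpM2l.
  have e3 : `|q| * A * h ^+ 2 <= `|q| * A * h by rewrite ler_wpM2l ?mulr_ge0.
  have e4 : 0 <= `|q| * A * h by rewrite !mulr_ge0// ltW.
  by rewrite /kap mulrBr mulr1 {1}/A; lra.
have AI : A <= (1 - kap * h)^-1.
  by rewrite -[leRHS]mul1r ler_pdivlMr// subr_gt0.
split => [x Ox|x y Ox Oy].
  apply: le_trans (zero_info_max bO A0 cf T xi0 net Ox) _.
  have h4 : 0 <= h ^+ 2 / 4 by apply: divr_ge0 => //; exact: sqr_ge0.
  by have := ler_wpM2r h4 AI; rewrite !mulrA.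
have t1 := T x y Ox Oy.
have t2 := dotv_le (g x) (y - x).
have t3 : enorm (g x) * enorm (y - x) <= C * A * enorm (y - x).
  rewrite ler_wpM2r ?enorm_ge0//; apply: le_trans (gm x Ox) _.
  by apply: le_trans m1A _; rewrite ler_piMr//; exact: mulr_ge0.
have t4 := dotvv_ge0 (y - x).
have t5 : 0 <= A * dotv (y - x) (y - x) by rewrite mulr_ge0.
apply: (@le_trans _ _ (A * (C * enorm (y - x) + dotv (y - x) (y - x)))); last first.
  by rewrite ler_wpM2r// addr_ge0// mulr_ge0// enorm_ge0.
move: t1 t2; rewrite !ler_norml => /andP[? ?] /andP[? ?]; apply/andP; split; lra.
Qed.

End zero_information.

(** * The central algorithm *)

Section recovery.
Context {R : realType} {d : nat}.
Local Notation V := 'rV[R]_d.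
Implicit Types (O : set V) (f : V -> R) (g : V -> V) (x y z : V).

(** The class is convex and symmetric, so it contains half the difference of two members; if they
    have the same information, this function has zero information. *)
Definition half_diff (fg1 fg2 : (V -> R) * (V -> V)) : (V -> R) * (V -> V) :=
  (fun x => 2^-1 * (fg1.1 x - fg2.1 x), fun x => 2^-1 *: (fg1.2 x - fg2.2 x)).

Lemma abs_cont_on_half_diff (h1 h2 h : R -> R) (a b : R) :
  (forall t, h t = 2^-1 * (h1 t - h2 t)) ->
  abs_cont_on h1 a b -> abs_cont_on h2 a b -> abs_cont_on h a b.
Proof.
move=> hE H1 H2 e e0; have [del1 del10 {}H1] := H1 e e0.
have [del2 del20 {}H2] := H2 e e0.
exists (Num.min del1 del2); first by rewrite lt_min del10.
move=> n s t st dst; rewrite lt_min => /andP[/(H1 _ _ _ st dst) e1 /(H2 _ _ _ st dst) e2].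
apply: (@le_lt_trans _ _ (2^-1 * (\sum_(k < n) `|h1 (t k) - h1 (s k)| +
    \sum_(k < n) `|h2 (t k) - h2 (s k)|))); last by lra.
rewrite -big_split/= mulr_sumr; apply: ler_sum => k _; rewrite !hE.
rewrite -mulrBr normrM gtr0_norm ?invr_gt0// ler_wpM2l ?invr_ge0//.
have -> : h1 (t k) - h2 (t k) - (h1 (s k) - h2 (s k)) =
  (h1 (t k) - h1 (s k)) - (h2 (t k) - h2 (s k)) by ring.
exact: ler_normB.
Qed.

Lemma good_point_half_diff (p q : R) O fg1 fg2 (u x : V) :
  good_point p q O fg1.1 fg1.2 u x -> good_point p q O fg2.1 fg2.2 u x ->
  good_point p q O (half_diff fg1 fg2).1 (half_diff fg1 fg2).2 u x.
Proof.
move=> [ac1 [d1 b1]] [ac2 [d2 b2]].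
have E t : dir_deriv_line (half_diff fg1 fg2).2 u x t =
    2^-1 * (dir_deriv_line fg1.2 u x t - dir_deriv_line fg2.2 u x t).
  by rewrite /dir_deriv_line /half_diff/= dotvZl dotvBl.
have Ef : dir_deriv_line (half_diff fg1 fg2).2 u x =
    2^-1 *: (dir_deriv_line fg1.2 u x - dir_deriv_line fg2.2 u x).
  by apply/funext => t; rewrite E.
split; [|split].
- move=> a b ab sub; apply: abs_cont_on_half_diff E _ _; [exact: ac1|exact: ac2].
- by rewrite Ef; apply: derivableZ; exact: derivableB.
- move: b1 b2; rewrite Ef !derive1E deriveZ ?deriveB//; last exact: derivableB.
  rewrite /half_diff/= dotvZl dotvBl !ler_norml => /andP[? ?] /andP[? ?].
  by rewrite /GRing.scale/=; apply/andP; split; lra.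
Qed.

Lemma WPD_half_diff (p q : R) O fg1 fg2 : WPD p q O fg1 -> WPD p q O fg2 ->
  WPD p q O (half_diff fg1 fg2).
Proof.
move=> [[cg1 c1] s1] [[cg2 c2] s2]; split; first split.
- move=> x; apply: cvgZl_tmp; apply: cvgB; [exact: cg1|exact: cg2].
- move=> x Ox e e0; have [r1 r10 H1] := c1 x Ox e e0; have [r2 r20 H2] := c2 x Ox e e0.
  exists (Num.min r1 r2); first by rewrite lt_min r10.
  move=> y Oy; rewrite lt_min => /andP[/(H1 y Oy) h1 /(H2 y Oy) h2].
  move: h1 h2; rewrite /half_diff/= dotvZl dotvBl !ler_norml => /andP[? ?] /andP[? ?].
  by apply/andP; split; lra.
- move=> u u1; have n1 := s1 u u1; have n2 := s2 u u1.
  apply/eqP; rewrite eq_le leb_outer_ge0 andbT -(leb_outer_setU0 n1 n2).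
  apply: leb_outer_le => x [intx ng]; apply: contrapT => /not_orP[g1 g2].
  apply: ng; apply: good_point_half_diff; apply: contrapT => ng.
    by apply: g1.
  by apply: g2.
Qed.

Lemma rec_err_le (p q B : R) O (xi : seq V) (w : V -> V -> R) :
  (forall x, O x -> forall e : R, 0 < e -> exists2 r : R, 0 < r &
     forall z, O z -> (forall i, `|z ord0 i - x ord0 i| < r) -> w x z < e) ->
  (forall fg, WPD p q O fg -> (forall y, y \in xi -> fg.1 y = 0 /\ fg.2 y = 0) ->
    (forall x, O x -> `|fg.1 x| <= B) /\
    (forall x z, O x -> O z -> `|fg.1 z - fg.1 x| <= w x z)) ->
  (rec_err O (WPD p q O) xi <= B%:E)%E.
Proof.
move=> cw zero.
pose FI I := [set fg | WPD p q O fg /\ info xi fg = I].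
pose S I x := [set fg.1 x | fg in FI I].
(* The midpoint of the range of values at [x] compatible with the information. Its error is at most
   half the length of that range, that is [B]. *)
pose phi I x : R := (sup (S I x) + inf (S I x)) / 2.
have diff I fg1 fg2 : FI I fg1 -> FI I fg2 ->
    (forall x, O x -> `|fg1.1 x - fg2.1 x| <= 2 * B) /\
    (forall x z, O x -> O z ->
       `|(fg1.1 z - fg2.1 z) - (fg1.1 x - fg2.1 x)| <= 2 * w x z).
  move=> [W1 I1] [W2 I2]; have [|b1 b2] := zero _ (WPD_half_diff W1 W2).
    move=> y yxi; move: I1; rewrite -I2 => /eq_in_map/(_ y yxi)[e1 e2].
    by rewrite /half_diff/= e1 e2 !subrr mulr0 scaler0.
  split=> [x Ox|x z Ox Oz].
    have := b1 x Ox; rewrite /half_diff/= normrM gtr0_norm ?invr_gt0//.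
    by rewrite ler_pdivrMl.
  have := b2 x z Ox Oz; rewrite /half_diff/= -mulrBr normrM gtr0_norm ?invr_gt0//.
  by rewrite ler_pdivrMl.
have supP I fg x : FI I fg -> O x ->
    [/\ has_sup (S I x), has_inf (S I x), inf (S I x) <= fg.1 x,
        fg.1 x <= sup (S I x) & sup (S I x) - inf (S I x) <= 2 * B].
  move=> Ifg Ox.
  have Sn : S I x !=set0 by exists (fg.1 x), fg.
  have hs : has_sup (S I x).
    split => //; exists (fg.1 x + 2 * B) => _ [fg' Ifg' <-].
    have [/(_ x Ox) + _] := diff I _ _ Ifg' Ifg; rewrite ler_norml => /andP[_].
    by lra.
  have hi : has_inf (S I x).
    split => //; exists (fg.1 x - 2 * B) => _ [fg' Ifg' <-].
    have [/(_ x Ox) + _] := diff I _ _ Ifg' Ifg; rewrite ler_norml => /andP[+ _].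
    by lra.
  split => //.
  - by apply: ge_inf; [exact: hi.2|exists fg].
  - by apply: ub_le_sup; [exact: hs.2|exists fg].
  - rewrite lerBlDr; apply: ge_sup => // _ [fg1 Ifg1 <-].
    rewrite -lerBlDl; apply: lb_le_inf => // _ [fg2 Ifg2 <-].
    have [/(_ x Ox) + _] := diff I _ _ Ifg1 Ifg2; rewrite ler_norml => /andP[_].
    by lra.
apply: ge_ereal_inf; exists (alg_err O (WPD p q O) xi phi).
  exists phi => //= I.
  (* For information that no member of the class produces, [sup] and [inf] of the empty set make
     [phi I] constant, hence continuous. *)
  have [FI0|] := pselect (FI I = set0).
    have -> : phi I = (fun=> phi I 0).
      by apply/funext => x; rewrite /phi /S FI0 !image_set0.
    exact: cst_continuous.
  move=> /eqP/set0P[fg Ifg]; apply/within_continuous_realP => x Ox e e0.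
  have [[/C1_within_continuous/within_continuous_realP cf _] _] := Ifg.
  have e4 : 0 < e / 4 by rewrite divr_gt0.
  have [r1 r10 H1] := cf x Ox _ e4; have [r2 r20 H2] := cw x Ox _ e4.
  exists (Num.min r1 r2); first by rewrite lt_min r10.
  move=> z Oz zx.
  have {}H1 : `|fg.1 z - fg.1 x| < e / 4.
    by apply: H1 => // i; have := zx i; rewrite lt_min => /andP[].
  have {}H2 : w x z < e / 4.
    by apply: H2 => // i; have := zx i; rewrite lt_min => /andP[].
  (* All members with information [I] are equicontinuous at [x]: one share [e / 4] comes from the
     fixed member [fg], two from the modulus of the difference with it. Suprema and infima inherit
     the bound. *)
  have close fg' : FI I fg' -> `|fg'.1 z - fg'.1 x| <= 3 * (e / 4).
    move=> Ifg'; have [_ /(_ x z Ox Oz)] := diff I _ _ Ifg' Ifg.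
    move: H1; rewrite !ler_norml !ltr_norml => /andP[? ?] /andP[? ?].
    by apply/andP; split; lra.
  have [hsx hix _ _ _] := supP I fg x Ifg Ox.
  have [hsz hiz _ _ _] := supP I fg z Ifg Oz.
  have s1 : sup (S I z) <= sup (S I x) + 3 * (e / 4).
    apply: ge_sup; first exact: hsz.1.
    move=> _ [fg' Ifg' <-]; have := close _ Ifg'; have [_ _ _ + _] := supP I _ x Ifg' Ox.
    by rewrite ler_norml => ? /andP[? ?]; lra.
  have s2 : sup (S I x) <= sup (S I z) + 3 * (e / 4).
    apply: ge_sup; first exact: hsx.1.
    move=> _ [fg' Ifg' <-]; have := close _ Ifg'; have [_ _ _ + _] := supP I _ z Ifg' Oz.
    by rewrite ler_norml => ? /andP[? ?]; lra.
  have s3 : inf (S I x) - 3 * (e / 4) <= inf (S I z).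
    apply: lb_le_inf; first exact: hiz.1.
    move=> _ [fg' Ifg' <-]; have := close _ Ifg'; have [_ _ + _ _] := supP I _ x Ifg' Ox.
    by rewrite ler_norml => ? /andP[? ?]; lra.
  have s4 : inf (S I z) - 3 * (e / 4) <= inf (S I x).
    apply: lb_le_inf; first exact: hix.1.
    move=> _ [fg' Ifg' <-]; have := close _ Ifg'; have [_ _ + _ _] := supP I _ z Ifg' Oz.
    by rewrite ler_norml => ? /andP[? ?]; lra.
  by rewrite /phi ltr_norml; apply/andP; split; lra.
apply: ge_ereal_sup => _ [fg [x [W Ox ->]]]; rewrite lee_fin.
have [_ _ h1 h2 h3] := supP (info xi fg) fg x (conj W erefl) Ox.
by rewrite /phi ler_norml; apply/andP; split; lra.
Qed.

End recovery.

(** * Counting grid cells and constructing the nodes *)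

Section grid.
Context {R : realType} {d : nat}.
Local Notation V := 'rV[R]_d.
Local Notation Z := 'rV[int]_d.
Implicit Types (O : set V) (x y : V) (z : Z).

Definition cell (sig : R) x : Z := \row_i Num.floor (x ord0 i / sig).
Definition corner (sig : R) z : V := \row_i (sig * (z ord0 i)%:~R).

Lemma add_const_mxE x (t : R) i : (x + const_mx t) ord0 i = x ord0 i + t.
Proof. by rewrite !mxE. Qed.

Lemma sub_const_mxE x (t : R) i : (x - const_mx t) ord0 i = x ord0 i - t.
Proof. by rewrite !mxE. Qed.

Lemma cellP (sig : R) x i : 0 < sig ->
  corner sig (cell sig x) ord0 i <= x ord0 i < corner sig (cell sig x) ord0 i + sig.
Proof.
move=> sig0; rewrite !mxE; have /andP[h1 h2] := floor_itv (x ord0 i / sig).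
rewrite mulrC -ler_pdivlMr// h1/=.
by move: h2; rewrite intrD ltr_pdivrMr// mulrDl mul1r.
Qed.

Lemma box_cells (sig : R) (a b : V) : 0 < sig -> (forall i, a ord0 i <= b ord0 i) ->
  exists2 l : seq Z, (size l)%:R * sig ^+ d <= box_vol a b &
    forall z, (forall i, a ord0 i <= corner sig z ord0 i /\
                         corner sig z ord0 i + sig <= b ord0 i) -> z \in l.
Proof.
move=> sig0 ab.
pose lo i := Num.ceil (a ord0 i / sig).
pose hi i := Num.floor (b ord0 i / sig).
(* A side too short to contain a grid interval may have [hi i < lo i]; the absolute value would then
   count cells that do not exist. *)
pose m i : nat := if lo i <= hi i then `|hi i - lo i|%N else 0%N.
pose val (f : {dffun forall i : 'I_d, 'I_(m i)}) : Z := \row_i (lo i + (f i : nat)%:Z).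
exists (map val (enum {: {dffun forall i : 'I_d, 'I_(m i)}})).
  rewrite size_map -cardE card_dep_ffun foldrE big_map big_enum/=.
  rewrite natr_prod -[in sig ^+ d](card_ord d) -prodr_const -big_split/=.
  apply: ler_prod => i _; rewrite card_ord; apply/andP; split.
    by rewrite mulr_ge0// ltW.
  rewrite /m; case: ifPn => [lohi|_]; last by rewrite mul0r subr_ge0.
  have -> : `|hi i - lo i|%N%:R = (hi i)%:~R - (lo i)%:~R :> R.
    rewrite -intrB -[in RHS](@gez0_abs (hi i - lo i)) ?subr_ge0//.
  rewrite -ler_pdivlMr// mulrBl lerB//; first exact: floor_le.
  exact: ceil_ge.
move=> z zab.
have zlo i : lo i <= z ord0 i.
  rewrite ceil_le_int ler_pdivrMr// mulrC.
  by have [] := zab i; rewrite mxE.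
have zhi i : z ord0 i + 1 <= hi i.
  rewrite floor_ge_int ler_pdivlMr// intrD mulrDl mul1r mulrC.
  by have [_] := zab i; rewrite mxE.
have lt i : (`|z ord0 i - lo i|%N < m i)%N.
  rewrite /m ifT; last by rewrite (le_trans (zlo i))// (le_trans _ (zhi i))// lerDl.
  rewrite -ltz_nat !gez0_abs ?subr_ge0//.
    by rewrite ltrD2r (lt_le_trans _ (zhi i))// ltrDl.
  by rewrite (le_trans (zlo i))// (le_trans _ (zhi i))// lerDl.
apply/mapP; exists (finfun (fun i => Ordinal (lt i))); first by rewrite mem_enum.
apply/rowP => i; rewrite mxE ffunE/= gez0_abs ?subr_ge0//.
by ring.
Qed.

Lemma exists_lower_bound (t : nat -> R) N : (forall k, 0 < t k) ->
  exists2 s : R, 0 < s & forall k, (k < N)%N -> s <= t k.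
Proof.
move=> t0; elim: N => [|N [s s0 IH]]; first by exists 1.
exists (Num.min s (t N)); first by rewrite lt_min s0 t0.
move=> k; rewrite ltnS leq_eqVlt => /predU1P[->|/IH h]; first by rewrite ge_min lexx orbT.
by rewrite ge_min h.
Qed.

Lemma sum_geometric_half N : \sum_(k < N) (2 ^ k.+1)%:R^-1 <= 1 :> R.
Proof.
suff -> : \sum_(k < N) (2 ^ k.+1)%:R^-1 = 1 - (2 ^ N)%:R^-1 :> R.
  by rewrite gerBl invr_ge0.
elim: N => [|N IH]; first by rewrite big_ord0 expn0 invr1 subrr.
rewrite big_ord_recr/= IH expnS natrM invfM.
by rewrite -addrA; congr (_ + _); field; rewrite pnatr_eq0 expn_eq0.
Qed.

(** A near-optimal cover by boxes is enlarged to an open one and reduced to finitely many boxes by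
    compactness; a fine grid cell meeting [O] then lies inside one slightly larger box, and
    [box_cells] counts these cells by volume. *)
Lemma cells_upper_count O (eta : R) : compact O -> leb_outer O \is a fin_num ->
  0 < eta -> exists2 sig0 : R, 0 < sig0 & forall sig, 0 < sig < sig0 ->
  exists l : seq Z, [/\ uniq l, (forall x, O x -> cell sig x \in l) &
    (size l)%:R * sig ^+ d <= fine (leb_outer O) + eta].
Proof.
move=> cO Ofin eta0.
have eta2 : 0 < eta / 2 by rewrite divr_gt0.
have [a [b [ab cov sumab]]] := leb_outer_near eta2 Ofin.
pose e k := eta / 2 / (2 ^ k.+1)%:R.
have e0 k : 0 < e k by rewrite divr_gt0// ltr0n expn_gt0.
have [t Ht] : {t : nat -> R & forall k, 0 < t k /\ forall s, 0 <= s <= t k ->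
    \prod_i (b k ord0 i - a k ord0 i + 2 * s) <= box_vol (a k) (b k) + e k}.
  apply: (@choice _ _ (fun k t => 0 < t /\ forall s, 0 <= s <= t ->
    \prod_i (b k ord0 i - a k ord0 i + 2 * s) <= box_vol (a k) (b k) + e k)) => k.
  have [t t0 tP] := prod_enlarge (fun i => b k ord0 i - a k ord0 i) (e0 k).
  by exists t.
(* Half of the margin [t k] makes the box open around [O], the other half has room for a cell of
   side [sig < tau k]. *)
pose tau k := t k / 2.
have tau0 k : 0 < tau k by rewrite divr_gt0//; have [] := Ht k.
pose U k : set V := interior (box (a k - const_mx (tau k)) (b k + const_mx (tau k))).
have [D' _ cov'] : finite_subset_cover [set: nat] U O.
  move: cO; rewrite compact_cover; apply => [i _|]; first exact: open_interior.
  move=> x /cov[k _ xk]; exists k => //; apply/interior_boxP.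
  exists (tau k) => // y yx i; have := xk i; have := yx i; rewrite !mxE ltr_norml.
  by move=> /andP[? ?] /andP[? ?]; apply/andP; split; lra.
pose N := (\max_(k <- finmap.enum_fset D') k).+1.
have [sig0 sig00 Hsig0] := exists_lower_bound N tau0.
exists sig0 => // sig /andP[sigp sigs].
have [L HL] : {L : nat -> seq Z & forall k,
    (size (L k))%:R * sig ^+ d <= box_vol (a k) (b k) + e k /\
    forall z, (forall i, a k ord0 i - t k <= corner sig z ord0 i /\
                corner sig z ord0 i + sig <= b k ord0 i + t k) -> z \in L k}.
  apply: (@choice _ _ (fun k L => (size L)%:R * sig ^+ d <= box_vol (a k) (b k) + e k /\
    forall z, (forall i, a k ord0 i - t k <= corner sig z ord0 i /\
                corner sig z ord0 i + sig <= b k ord0 i + t k) -> z \in L)) => k.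
  have [t0 tP] := Ht k.
  have [|l l1 l2] := @box_cells sig (a k - const_mx (t k)) (b k + const_mx (t k)) sigp.
    by move=> i; rewrite !mxE; have := ab k i; move: t0; lra.
  exists l; split.
    apply: (le_trans l1); apply: le_trans (tP (t k) _); last by rewrite lexx ltW.
    rewrite le_eqVlt; apply/orP; left; apply/eqP; apply: eq_bigr => i _.
    by rewrite !mxE; ring.
  move=> z zab; apply: l2 => i; have [] := zab i.
  by rewrite sub_const_mxE add_const_mxE.
exists (undup (flatten [seq L k | k <- iota 0 N])); split; first exact: undup_uniq.
  move=> x Ox; rewrite mem_undup; apply/flattenP.
  have [k kD xk] := cov' x Ox.
  have kN : (k < N)%N.
    by rewrite /N ltnS; apply: (@leq_bigmax_seq _ (finmap.enum_fset D') xpredT id k).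
  exists (L k); first by apply/mapP; exists k => //; rewrite mem_iota.
  have [_] := HL k; apply => i.
  have sk : sig < tau k by apply: lt_le_trans sigs (Hsig0 k kN).
  have tk : t k = 2 * tau k by rewrite /tau; field.
  have := cellP x i sigp.
  have := interior_subset xk i; rewrite sub_const_mxE add_const_mxE.
  by move=> /andP[? ?] /andP[? ?]; split; lra.
have sizeL : (size (undup (flatten [seq L k | k <- iota 0 N])) <=
    \sum_(k < N) size (L k))%N.
  apply: (leq_trans (size_undup _)); rewrite size_flatten /shape -map_comp.
  by rewrite sumnE big_map -[iota 0 N]/(index_iota 0 N) big_mkord.
apply: (@le_trans _ _ (\sum_(k < N) (box_vol (a k) (b k) + e k))).
  apply: (@le_trans _ _ ((\sum_(k < N) size (L k))%N%:R * sig ^+ d)).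
    by rewrite ler_wpM2r ?exprn_ge0 ?ler_nat// ltW.
  rewrite natr_sum mulr_suml; apply: ler_sum => k _.
  by have [] := HL k.
rewrite big_split/= (_ : eta = eta / 2 + eta / 2); last by field.
rewrite addrA; apply: lerD.
  rewrite -lee_fin EFinD fineK// -sumEFin; apply: le_trans (ltW sumab).
  rewrite -(big_mkord xpredT (fun k => (box_vol (a k) (b k))%:E)).
  by apply: nneseries_lim_ge => k _ _; rewrite lee_fin box_vol_ge0.
apply: (@le_trans _ _ (eta / 2 * \sum_(k < N) (2 ^ k.+1)%:R^-1)).
  by rewrite mulr_sumr.
by apply: ler_piMr; [exact: ltW|exact: sum_geometric_half].
Qed.

End grid.

(** Bernoulli's inequality. *)
Lemma one_minus_exp_ge (R : realType) (e : R) n : 0 <= e <= 1 ->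
  1 - n%:R * e <= (1 - e) ^+ n.
Proof.
move=> /andP[e0 e1]; elim: n => [|n IH]; first by rewrite mul0r subr0 expr0.
rewrite exprS -natr1; have h : 0 <= 1 - e by rewrite subr_ge0.
apply: (le_trans _ (ler_wpM2l h IH)).
have h2 : 0 <= n%:R * e * e by rewrite !mulr_ge0.
by lra.
Qed.

(** * From covering density to a finite covering of a cube *)

Section density.
Context {R : realType} {d : nat}.
Local Notation V := 'rV[R]_d.
Implicit Types (O : set V) (x y : V).
Context (d0 : (0 < d)%N).

Lemma leb_outer_box_gt0 (a b : V) : (forall i, a ord0 i < b ord0 i) ->
  (0 < leb_outer (box a b))%E.
Proof.
move=> ab; rewrite lt_def leb_outer_ge0 andbT; apply/eqP.
by move: a b ab; case: d d0 => // n _ a b ab; exact: leb_outer_box_neq0.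
Qed.

Lemma box_vol_const (s t : R) : box_vol (const_mx s : V) (const_mx t) = (t - s) ^+ d.
Proof.
rewrite /box_vol -[in RHS](card_ord d) -prodr_const.
by apply: eq_bigr => i _; rewrite !mxE.
Qed.

Lemma cubeE (T : R) : cube T = box (const_mx (- T)) (const_mx T) :> set V.
Proof. by apply/seteqP; split => x xT i; have := xT i; rewrite !mxE ler_norml. Qed.

Lemma leb_outer_cube_le (T : R) : 0 <= T ->
  (leb_outer (cube T : set V) <= ((2 * T) ^+ d)%:E)%E.
Proof.
move=> T0; rewrite cubeE (le_trans (leb_outer_box _ _))//.
  by move=> i; rewrite !mxE; lra.
by rewrite box_vol_const lee_fin lerXn2r ?nnegrE; lra.
Qed.

Lemma leb_outer_sub_cube_fin O (T : R) : 0 <= T -> O `<=` cube T ->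
  leb_outer O \is a fin_num.
Proof.
move=> T0 OT; rewrite ge0_fin_numE ?leb_outer_ge0//.
apply: le_lt_trans (leb_outer_le OT) _.
by rewrite (le_lt_trans (leb_outer_cube_le T0))// ltry.
Qed.

Lemma leb_outer_cube_gt0 (T : R) : 0 < T -> (0 < leb_outer (cube T : set V))%E.
Proof. by move=> T0; rewrite cubeE leb_outer_box_gt0// => i; rewrite !mxE; lra. Qed.

Lemma leb_outer_interior_gt0 O : interior O !=set0 -> (0 < leb_outer O)%E.
Proof.
move=> [c /interior_boxP[r r0 rO]].
have r2 : 0 < r / 2 by rewrite divr_gt0.
apply: (@lt_le_trans _ _ (leb_outer (box (c - const_mx (r / 2)) (c + const_mx (r / 2))))).
  by apply: leb_outer_box_gt0 => i; rewrite sub_const_mxE add_const_mxE; lra.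
apply: leb_outer_le => x xc; apply: rO => i; have := xc i.
by rewrite sub_const_mxE add_const_mxE ltr_norml => /andP[? ?]; apply/andP; split; lra.
Qed.

Lemma unit_ball_vol_fin : @unit_ball_vol R d \is a fin_num.
Proof.
apply: (@leb_outer_sub_cube_fin _ 1) => // x; rewrite /eball/= subr0 => x1 i.
exact: le_trans (coord_le_enorm _ _) x1.
Qed.

Lemma unit_ball_vol_gt0 : (0 < @unit_ball_vol R d)%E.
Proof.
apply: leb_outer_interior_gt0; exists 0; apply/interior_boxP.
exists d.+1%:R^-1; first by [].
move=> x x0; rewrite /eball/= subr0; apply: ltW.
rewrite -[ltRHS](@mulfV _ d.+1%:R) ?pnatr_eq0//; apply: enorm_lt_coord => // i.
by apply: ltW; have := x0 i; rewrite mxE subr0.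
Qed.

Lemma unit_ball_vol_fine_gt0 : 0 < fine (@unit_ball_vol R d).
Proof. by rewrite -lte_fin fineK ?unit_ball_vol_fin// unit_ball_vol_gt0. Qed.

Lemma leb_outer_eball_ge (c : V) (r : R) : 0 < r ->
  ((r ^+ d * fine (@unit_ball_vol R d))%:E <= leb_outer (eball c r))%E.
Proof.
move=> r0; rewrite EFinM fineK ?unit_ball_vol_fin//.
apply: (@leb_outer_affine _ _ _ _ c) => // x; rewrite /eball/= subr0 => x1.
by rewrite addrAC subrr add0r enormZ gtr0_norm// ler_piMr// ltW.
Qed.

(** At an [n] where the count is maximal no later index can satisfy [P], since it would raise the
    count. *)
Lemma bounded_count_finite (P : pred nat) (B : nat) :
  (forall n, (size [seq k <- iota 0 n | P k] <= B)%N) ->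
  exists n, forall k, P k -> (k < n)%N.
Proof.
move=> HB; pose Q m := `[< exists n, size [seq k <- iota 0 n | P k] = m >].
have Q0 : exists m, Q m by exists 0%N; apply/asboolP; exists 0%N.
have QB m : Q m -> (m <= B)%N by move=> /asboolP[n <-].
case: (ex_maxnP Q0 QB) => m /asboolP[n nm] mmax; exists n => k Pk.
rewrite ltnNge; apply/negP => nk.
have : (size [seq k <- iota 0 k.+1 | P k] <= m)%N by apply: mmax; apply/asboolP; exists k.+1.
have -> : k.+1 = (n + (k - n).+1)%N by rewrite addnS subnKC.
rewrite iotaD filter_cat size_cat nm add0n.
rewrite -[leqRHS]addn0 leq_add2l leqn0 size_filter eqn0Ngt -has_count => /negP; apply.
by apply/hasP; exists k => //; rewrite mem_iota nk addnS ltnS subnKC//=.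
Qed.

(** In a large cube of half side [T] where the density is below [D1], the balls meeting the
    concentric cube of half side [T - 2 * r] lie entirely in the large one, so their number is
    bounded by volume; they cover the smaller cube, which is translated to [[0, s]^d]. *)
Lemma Theta_local_cover (D : R) : (@Theta R d < D%:E)%E ->
  exists (r s : R) (cs : seq V), [/\ 0 < r, 0 < s,
    (forall x : V, (forall i, 0 <= x ord0 i <= s) ->
       exists2 c, c \in cs & enorm (x - c) <= r),
    (forall c, c \in cs -> exists2 x : V, (forall i, 0 <= x ord0 i <= s) &
       enorm (x - c) <= r) &
    (size cs)%:R * r ^+ d * fine (@unit_ball_vol R d) <= D * s ^+ d].
Proof.
move=> /ereal_inf_lt[_ [r [c [[r0 cov] ->]]] dD].
have nu0 := unit_ball_vol_fine_gt0.
set nu := fine _ in nu0 *.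
have [D1 dD1 D1D] : exists2 D1 : R, (dens r c < D1%:E)%E & D1 < D.
  case: (dens r c) dD => [x xD|//|_].
    by exists ((x + D) / 2); rewrite ?lte_fin; move: xD; rewrite lte_fin; lra.
  by exists (D - 1); rewrite ?ltNyr// ltrBlDr ltrDl.
pose S T := (\sum_(0 <= k <oo) leb_outer (eball (c k) r `&` cube T))%E.
have S0 T : (0 <= S T)%E by apply: nneseries_ge0 => k _ _; exact: leb_outer_ge0.
have ratio M : exists2 T, M <= T & (S T * ((fine (leb_outer (cube T : set V)))^-1)%:E < D1%:E)%E.
  have : (ereal_inf [set (S T * ((fine (leb_outer (cube T : set V)))^-1)%:E)%E
     | T in [set T | (M <= T)%R]] < D1%:E)%E.
    by apply: le_lt_trans dD1; apply: ereal_sup_ubound; exists M.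
  by move=> /ereal_inf_lt[_ [T MT <-]]; exists T.
have D10 : 0 < D1.
  have [T _ lt] := ratio 0; rewrite -lte_fin; apply: le_lt_trans lt.
  by rewrite mule_ge0// lee_fin invr_ge0 fine_ge0// leb_outer_ge0.
have D0 : 0 < D by exact: lt_trans D1D.
(* By Bernoulli's inequality the gap between [D1] and [D] absorbs the factor [(1 - e) ^+ d], the
   cost of replacing [T] by [T - 2 * r >= (1 - e) * T]. *)
pose e := (D - D1) / (d.+1%:R * D).
have dD0 : 0 < d.+1%:R * D by rewrite mulr_gt0.
have e0 : 0 < e by rewrite divr_gt0// subr_gt0.
have e1 : e < 1.
  rewrite ltr_pdivrMr// mul1r (@lt_le_trans _ _ D)//; first by rewrite gtrBl.
  by rewrite ler_peMl ?ler1n// ltW.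
have DD1 : D1 <= D * (1 - e) ^+ d.
  apply: (@le_trans _ _ (D * (1 - d%:R * e))); last first.
    by rewrite ler_pM2l// one_minus_exp_ge// !ltW.
  have -> : D1 = D - d.+1%:R * D * e by rewrite mulrC divfK ?gt_eqF//; ring.
  by rewrite -natr1; have := mulr_gt0 D0 e0; lra.
have [T MT lt] := ratio (2 * r / e).
have T0 : 0 < T by apply: lt_le_trans MT; rewrite divr_gt0// mulr_gt0.
have eT : 2 * r <= T * e by rewrite -ler_pdivrMr.
have T2r : 0 < T - 2 * r.
  by rewrite subr_gt0 (le_lt_trans eT)// gtr_pMr.
have cT0 : 0 < fine (leb_outer (cube T : set V)).
  rewrite -lte_fin fineK; last by apply: (@leb_outer_sub_cube_fin _ T) => //; exact: ltW.
  exact: leb_outer_cube_gt0.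
have cTle : fine (leb_outer (cube T : set V)) <= (2 * T) ^+ d.
  rewrite -lee_fin fineK; last by apply: (@leb_outer_sub_cube_fin _ T) => //; exact: ltW.
  by apply: leb_outer_cube_le; exact: ltW.
pose s := 2 * (T - 2 * r).
have s0 : 0 < s by rewrite mulr_gt0.
have ST : (S T <= (D * s ^+ d)%:E)%E.
  move: lt; rewrite lte_pdivrMr// -EFinM => /ltW /le_trans; apply.
  rewrite lee_fin (@le_trans _ _ (D1 * (2 * T) ^+ d))//; first by rewrite ler_pM2l.
  rewrite (@le_trans _ _ (D * (1 - e) ^+ d * (2 * T) ^+ d))//.
    by rewrite ler_wpM2r// exprn_ge0// mulr_ge0// ltW.
  rewrite -mulrA ler_pM2l// -exprMn; apply: lerXn2r; rewrite ?nnegrE.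
  - by apply: mulr_ge0; [rewrite subr_ge0 ltW|rewrite mulr_ge0// ltW].
  - exact: ltW.
  - by rewrite /s; lra.
pose P k := `[< exists2 x : V, cube (T - 2 * r) x & eball (c k) r x >].
have PT k : P k -> eball (c k) r `<=` cube T.
  move=> /asboolP[x xT xk] y yk i.
  have := le_trans (coord_le_enorm _ i) yk; have := le_trans (coord_le_enorm _ i) xk.
  have := xT i; rewrite !mxE !ler_norml => /andP[? ?] /andP[? ?] /andP[? ?].
  by apply/andP; split; lra.
have rnu : 0 < r ^+ d * nu by rewrite mulr_gt0// exprn_gt0.
have count n : (size [seq k <- iota 0 n | P k])%:R * (r ^+ d * nu) <= D * s ^+ d.
  rewrite -lee_fin; apply: le_trans ST.
  apply: le_trans (@nneseries_lim_ge _ _ xpredT 0 n _); last first.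
    by move=> k _ _; exact: leb_outer_ge0.
  apply: (@le_trans _ _ (\sum_(0 <= k < n | P k) (r ^+ d * nu)%:E)%E).
    rewrite sumEFin lee_fin -big_filter big_const_seq count_predT iter_addr_0 mulr_natl.
    by rewrite /index_iota subn0.
  rewrite [leRHS](bigID P)/=.
  apply: (@le_trans _ _ (\sum_(0 <= k < n | P k) leb_outer (eball (c k) r `&` cube T))%E).
    apply: lee_sum => k Pk; rewrite (setIidl (PT k Pk)).
    exact: leb_outer_eball_ge.
  by rewrite leeDl// sume_ge0// => k _; exact: leb_outer_ge0.
have [n nP] : exists n, forall k, P k -> (k < n)%N.
  apply: (@bounded_count_finite _ (Num.truncn (D * s ^+ d / (r ^+ d * nu)))) => n.
  have X0 : 0 <= D * s ^+ d / (r ^+ d * nu).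
    by apply: divr_ge0; [rewrite mulr_ge0 ?exprn_ge0// ltW|exact: ltW].
  by rewrite truncn_ge_nat// ler_pdivlMr.
pose h := T - 2 * r.
exists r, s, [seq c k + const_mx h | k <- [seq k <- iota 0 n | P k]]; split => //.
- move=> x xs; pose y := x - const_mx h.
  have yT : cube (T - 2 * r) y.
    move=> i; rewrite sub_const_mxE ler_norml; have := xs i; rewrite /s /h => /andP[? ?].
    by apply/andP; split; lra.
  have [k _ yk] : (\bigcup_k eball (c k) r) y by rewrite cov.
  exists (c k + const_mx h); last by move: yk; rewrite /eball/= /y -addrA -opprD [const_mx _ + _]addrC.
  have Pk : P k by apply/asboolP; exists y.
  by apply/mapP; exists k => //; rewrite mem_filter Pk mem_iota add0n nP.
- move=> _ /mapP[k + ->]; rewrite mem_filter => /andP[/asboolP[x xT xk] _].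
  exists (x + const_mx h); last by rewrite opprD addrACA subrr addr0.
  move=> i; rewrite add_const_mxE; have := xT i; rewrite ler_norml /s /h => /andP[? ?].
  by apply/andP; split; lra.
- by rewrite size_map -mulrA.
Qed.

End density.

(** * Nodes in deep cells and in boundary cells *)

Section node_nets.
Context {R : realType} {d : nat}.
Local Notation V := 'rV[R]_d.
Local Notation Z := 'rV[int]_d.
Implicit Types (O : set V) (x y : V).
Context (d0 : (0 < d)%N).

Definition homothety (c : V) (lam : R) O : set V :=
  [set c + lam *: (x - c) | x in O].

Lemma cells_lower_count O (c : V) (lam sig : R) (l : seq Z) : 0 < lam -> 0 < sig ->
  leb_outer O \is a fin_num ->
  (forall x, homothety c lam O x -> cell sig x \in l) ->
  lam ^+ d * fine (leb_outer O) <= (size l)%:R * sig ^+ d.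
Proof.
move=> lam0 sig0 Ofin Hl; rewrite -lee_fin EFinM fineK//.
apply: (@le_trans _ _ (leb_outer (homothety c lam O))).
  apply: (@leb_outer_affine _ _ _ _ (c - lam *: c)) => // x Ox.
  by exists x => //; apply/rowP => i; rewrite !mxE; ring.
pose a k : V := corner sig (nth 0 l k).
apply: (@le_trans _ _ (\sum_(k < size l) box_vol (a k) (a k + const_mx sig))%:E).
  apply: (@leb_outer_finite_boxes _ _ _ _ a (fun k => a k + const_mx sig)) =>
    // [k i _|x /Hl xl].
    by rewrite add_const_mxE lerDl ltW.
  exists (index (cell sig x) l); first by rewrite index_mem.
  move=> i; rewrite add_const_mxE /a nth_index//.
  by have /andP[-> /ltW ->] := cellP x i sig0.
rewrite lee_fin (eq_bigr (fun=> sig ^+ d)) ?sumr_const ?card_ord ?mulr_natl// => k _.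
rewrite /box_vol -[in RHS](card_ord d) -prodr_const.
by apply: eq_bigr => i _; rewrite add_const_mxE; ring.
Qed.

(** The position of [x] among the [K.+1 ^ d] equal parts of its cell; the truncated number is below
    [K.+1], so [inord] does not alter it. *)
Definition subcell K (sig : R) x : {ffun 'I_d -> 'I_K.+1} :=
  [ffun i => inord (Num.truncn (K.+1%:R * (x ord0 i / sig - (cell sig x ord0 i)%:~R)))].

Lemma subcell_close K (sig : R) x y : 0 < sig -> cell sig x = cell sig y ->
  subcell K sig x = subcell K sig y ->
  forall i, `|x ord0 i - y ord0 i| <= sig / K.+1%:R.
Proof.
move=> sig0 cxy sxy i.
have frac (z : V) : 0 <= K.+1%:R * (z ord0 i / sig - (cell sig z ord0 i)%:~R) < K.+1%:R.
  have /andP[h1 h2] := floor_itv (z ord0 i / sig); rewrite intrD in h2.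
  rewrite mxE mulr_ge0 ?subr_ge0//=.
  by rewrite -[ltRHS]mulr1 ltr_pM2l// ltrBlDl.
have tr (z : V) : (subcell K sig z i)%:R <=
    K.+1%:R * (z ord0 i / sig - (cell sig z ord0 i)%:~R) < (subcell K sig z i)%:R + 1.
  have /andP[f1 f2] := frac z; have /andP[h1 h2] := truncn_itv f1.
  rewrite ffunE inordK; last by rewrite -(ltr_nat R) (le_lt_trans h1).
  by rewrite h1 natr1.
have := tr x; have := tr y; rewrite cxy sxy.
move=> /andP[y1 y2] /andP[x1 x2].
have K0 : 0 < K.+1%:R / sig by rewrite divr_gt0.
rewrite -(ler_pM2l K0).
have -> : K.+1%:R / sig * (sig / K.+1%:R) = 1 :> R.
  by rewrite mulrA divfK ?gt_eqF// divff ?pnatr_eq0.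
rewrite -[K.+1%:R / sig]gtr0_norm// -normrM ler_norml.
by apply/andP; split; lra.
Qed.

(** [y] is a convex combination, with weight [1 - lam] on the second, of the preimage [x'] of [x]
    and a point within [rho] of [c]. *)
Lemma homothety_neighbourhood O (c : V) (lam rho : R) x y :
  (forall x y (t : R), O x -> O y -> 0 <= t <= 1 -> O ((1 - t) *: x + t *: y)) ->
  0 < lam < 1 -> (forall z : V, (forall i, `|z ord0 i - c ord0 i| < rho) -> O z) ->
  homothety c lam O x -> (forall i, `|y ord0 i - x ord0 i| < (1 - lam) * rho) -> O y.
Proof.
move=> cvx /andP[lam0 lam1] cO [x' Ox' xE] yx.
have l1 : 1 - lam != 0 by rewrite subr_eq0 eq_sym lt_eqF.
have l0 : 0 < 1 - lam by rewrite subr_gt0.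
have -> : y = (1 - (1 - lam)) *: x' + (1 - lam) *: (c + (1 - lam)^-1 *: (y - x)).
  by apply/rowP => i; rewrite -xE !mxE; field.
apply: (cvx) => //; last by apply/andP; split; lra.
apply: cO => i.
have -> : (c + (1 - lam)^-1 *: (y - x)) ord0 i - c ord0 i =
  (1 - lam)^-1 * (y ord0 i - x ord0 i) by rewrite !mxE; ring.
by rewrite normrM gtr0_norm ?invr_gt0// ltr_pdivrMl.
Qed.

(** Cells meeting the shrunk copy of [O] are deep and receive a scaled copy of [cs]; each other cell
    meeting [O] receives one node per subcell. The number of the latter cells is the upper count for
    [O] minus the lower count for the shrunk copy. *)
Lemma exists_node_net O (C : R) : convex_body O -> leb_outer O \is a fin_num ->
  (@Theta R d < +oo)%E ->
  (@Theta R d * leb_outer O * ((fine (@unit_ball_vol R d))^-1)%:E < C%:E)%E ->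
  exists2 h0 : R, 0 < h0 & forall h, 0 < h < h0 -> exists xi : seq V,
    [/\ (forall y, y \in xi -> O y), node_net O xi h & (size xi)%:R * h ^+ d <= C].
Proof.
move=> bO Ofin Tfin TC; have [cvx cO intO] := bO.
set mu := fine (leb_outer O).
have mu0 : 0 < mu by rewrite -lte_fin fineK// leb_outer_interior_gt0.
have nu0 : 0 < fine (@unit_ball_vol R d) by exact: unit_ball_vol_fine_gt0.
set nu := fine _ in nu0 TC.
have [D TD DC] : exists2 D : R, (@Theta R d < D%:E)%E & D * mu / nu < C.
  move: TC; rewrite -(fineK Ofin) -/mu -muleA -EFinM -lte_pdivlMr ?divr_gt0//.
  case: (@Theta R d) Tfin => [x _|//|_].
    rewrite lte_fin => xC; exists ((x + C / (mu / nu)) / 2).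
      by rewrite lte_fin; lra.
    rewrite -mulrA -ltr_pdivlMr ?divr_gt0//; lra.
  move=> _; exists (C / (mu / nu) - 1); first exact: ltNyr.
  by rewrite -mulrA -ltr_pdivlMr ?divr_gt0// gtrBl.
have [r [s [cs [r0 s0 covs meets cnt]]]] := Theta_local_cover d0 TD.
have [c cint] := intO; have /interior_boxP[rho rho0 rhoO] := cint.
set N := size cs in cnt.
(* With [sig = h * (s / r)], this many subdivisions bring the squared diameter of a subcell,
   [d%:R * (sig / K.+1%:R) ^+ 2], down to [h ^+ 2 / 2]. *)
pose K := Num.truncn (2 * d%:R * s / r).
have sr0 : 0 < s / r by rewrite divr_gt0.
have KP : 2 * d%:R * s / r < K.+1%:R.
  have X0 : 0 <= 2 * d%:R * s / r.
    by apply: divr_ge0; [rewrite !mulr_ge0// ltW|exact: ltW].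
  by have /andP[] := truncn_itv X0.
pose rs := (r / s) ^+ d; have rs0 : 0 < rs by rewrite exprn_gt0// divr_gt0.
pose Kd : R := (K.+1 ^ d)%:R.
have Kd0 : 0 < Kd by rewrite ltr0n expn_gt0.
have [Kd_ge0 rs_ge0 mu_ge0] : [/\ 0 <= Kd, 0 <= rs & 0 <= mu] by split; exact: ltW.
have KmR : 0 <= Kd * mu * rs by rewrite !mulr_ge0.
have dKmR : 0 <= d%:R * (Kd * mu * rs) by rewrite mulr_ge0.
have Nrs : N%:R * rs <= D / nu.
  rewrite /rs expr_div_n mulrA ler_pdivrMr ?exprn_gt0//.
  by rewrite mulrAC ler_pdivlMr.
(* The slack [G] is split in halves: [eta] bounds the excess in the cell count, [e] the volume lost
   by shrinking. The summand [G] in the denominator of [e] also ensures [e < 1]. *)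
pose G := C - D * mu / nu; have G0 : 0 < G by rewrite subr_gt0.
pose eta := G / 2 / ((N%:R + Kd) * rs + 1).
have q1 : 0 < (N%:R + Kd) * rs + 1.
  by rewrite ltr_wpDl// mulr_ge0// addr_ge0.
have eta0 : 0 < eta by rewrite !divr_gt0.
have q2 : 0 < d%:R * (Kd * mu * rs) + G by rewrite ltr_wpDl.
pose e := G / 2 / (d%:R * (Kd * mu * rs) + G).
have e0 : 0 < e by rewrite !divr_gt0.
have e1 : e < 1.
  rewrite ltr_pdivrMr// mul1r.
  by move: G0 dKmR; lra.
pose lam := 1 - e.
have lam0 : 0 < lam by rewrite subr_gt0.
have lam1 : lam < 1 by rewrite gtrBl.
have lamd : 1 - lam ^+ d <= d%:R * e.
  have e01 : 0 <= e <= 1 by rewrite (ltW e0) (ltW e1).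
  by have := one_minus_exp_ge d e01; rewrite -/lam; lra.
have total : (N%:R * (mu + eta) + Kd * (mu + eta - lam ^+ d * mu)) * rs <= C.
  have t1 : (N%:R + Kd) * rs * eta <= G / 2.
    rewrite /eta mulrA ler_pdivrMr// mulrC ler_wpM2l ?divr_ge0 ?(ltW G0)//.
    by rewrite lerDl.
  have t2 : Kd * mu * rs * (1 - lam ^+ d) <= G / 2.
    apply: le_trans (ler_wpM2l KmR lamd) _.
    have -> : Kd * mu * rs * (d%:R * e) =
      d%:R * (Kd * mu * rs) * (G / 2) / (d%:R * (Kd * mu * rs) + G) by rewrite /e; ring.
    rewrite ler_pdivrMr// mulrC ler_wpM2l ?divr_ge0 ?(ltW G0)//.
    by rewrite lerDl ltW.
  have t3 : N%:R * rs * mu <= D / nu * mu by rewrite ler_wpM2r.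
  by move: t1 t2 t3; rewrite /G; lra.
have [sig0 sig00 upper] := cells_upper_count cO Ofin eta0.
pose srr := s / r + 1; have srr0 : 0 < srr by rewrite addr_gt0.
(* The first bound makes the grid fine enough for [upper]. The second makes [sig + h] less than half
   of [(1 - lam) * rho], so that nodes placed for a deep cell stay in [O] and points of [O] in it
   are interior. *)
exists (Num.min (sig0 / (s / r)) ((1 - lam) * rho / srr / 2)).
  by rewrite lt_min !divr_gt0// mulr_gt0// subr_gt0.
move=> h /andP[h0]; rewrite lt_min => /andP[hs1 hs2].
pose sig := h * (s / r).
have sigp : 0 < sig by rewrite mulr_gt0.
have sigs : sig < sig0 by rewrite -ltr_pdivlMr.
have sigh : sig + h < (1 - lam) * rho / 2.
  have -> : sig + h = h * srr by rewrite /sig /srr; ring.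
  by rewrite -ltr_pdivlMr//; move: hs2; rewrite mulrAC.
have [l [ul lO lcnt]] := upper sig (introT andP (conj sigp sigs)).
pose deep (z : Z) := `[< exists2 x, homothety c lam O x & cell sig x = z >].
pose ld := [seq z <- l | deep z]; pose lb := [seq z <- l | ~~ deep z].
have homO x : homothety c lam O x -> O x.
  move=> xh; apply: homothety_neighbourhood cvx _ rhoO xh _; first by rewrite lam0.
  by move=> i; rewrite subrr normr0 mulr_gt0// subr_gt0.
have ldcnt : lam ^+ d * mu <= (size ld)%:R * sig ^+ d.
  apply: (@cells_lower_count _ c) => // x xh; rewrite mem_filter lO ?andbT; last exact: homO.
  by apply/asboolP; exists x.
have lsz : (size ld + size lb = size l)%N by rewrite !size_filter count_predC.
pose nodes1 := [seq corner sig z + (h / r) *: x | z <- ld, x <- cs].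
(* A subcell without points of [O] gets the default [c], which lies in [O], so every node is
   admissible. *)
pose rep (k : Z * {ffun 'I_d -> 'I_K.+1}) : V :=
  xget c [set x | [/\ O x, cell sig x = k.1 & subcell K sig x = k.2]].
pose nodes2 := [seq rep (z, w) | z <- lb, w <- enum {ffun 'I_d -> 'I_K.+1}].
exists (nodes1 ++ nodes2); split.
- move=> y; rewrite mem_cat => /orP[/allpairsP[[z x] [/= + xcs ->]]|/allpairsP[[z w] [/= _ _ ->]]].
    rewrite mem_filter => /andP[/asboolP[x' x'h cz] _].
    have [x0 x0s x0x] := meets x xcs.
    apply: homothety_neighbourhood cvx _ rhoO x'h _; first by rewrite lam0.
    move=> i; have := cellP x' i sigp; rewrite cz.
    set q := corner _ _; rewrite [(q + _) _ _]mxE [(_ *: x) _ _]mxE.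
    have := le_trans (coord_le_enorm _ i) x0x; rewrite !mxE.
    have hr0 : 0 < h / r by rewrite divr_gt0.
    have /andP[x00 x01] := x0s i.
    have y0 : 0 <= h / r * x0 ord0 i by rewrite mulr_ge0// ltW.
    have y1 : h / r * x0 ord0 i <= sig.
      by rewrite (_ : sig = h / r * s) ?ler_pM2l// /sig; ring.
    rewrite -(ler_pM2l hr0) divfK ?gt_eqF// -[in leLHS](gtr0_norm hr0) -normrM mulrBr.
    rewrite ler_norml ltr_norml => /andP[? ?] /andP[? ?].
    by move: sigh h0 sigp; move=> *; apply/andP; split; lra.
  rewrite /rep; case: xgetP => [x _ []//|_].
  by apply: rhoO => i; rewrite subrr normr0.
- move=> x Ox; have xl := lO x Ox; case: (boolP (deep (cell sig x))) => dx; last first.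
    right; pose k := (cell sig x, subcell K sig x).
    have [Oy cy sy] : [/\ O (rep k), cell sig (rep k) = k.1 & subcell K sig (rep k) = k.2].
      by rewrite /rep; case: xgetP => [y _ []//|/(_ x) []]; split.
    exists (rep k).
      rewrite mem_cat; apply/orP; right; apply/allpairsP; exists k; split => //=.
        by rewrite mem_filter dx.
      by rewrite mem_enum.
    have close := subcell_close sigp (esym cy) (esym sy).
    apply: (@le_trans _ _ (d%:R * (sig / K.+1%:R) ^+ 2)).
      by apply: dotvv_le_coord => i; rewrite !mxE; exact: close.
    rewrite /sig -mulrA exprMn mulrCA ler_wpM2l ?sqr_ge0//.
    have d1 : 1 <= d%:R :> R by rewrite ler1n.
    have Kp : 0 < K.+1%:R :> R by [].
    have w1 : d%:R * (s / r / K.+1%:R) <= 2^-1.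
      by rewrite mulrA ler_pdivrMr//; move: KP; rewrite -!mulrA; lra.
    have w0 : 0 <= s / r / K.+1%:R by rewrite divr_ge0// ltW.
    have w2 : s / r / K.+1%:R <= 1.
      apply: (@le_trans _ _ (d%:R * (s / r / K.+1%:R))); first by rewrite ler_peMl.
      by apply: le_trans w1 _; rewrite invf_le1 ?ler1n ?ltr0n.
    rewrite expr2 mulrA; apply: le_trans (ler_wpM2r w0 w1) _.
    by rewrite ler_piMr.
  left; move/asboolP: dx => [x' x'h cx'].
  have xx' i : `|x ord0 i - x' ord0 i| <= sig.
    have := cellP x i sigp; have := cellP x' i sigp; rewrite cx' ler_norml.
    by move=> /andP[? ?] /andP[? ?]; apply/andP; split; lra.
  split.
    apply/interior_boxP; exists ((1 - lam) * rho / 2).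
      by rewrite divr_gt0// mulr_gt0// subr_gt0.
    move=> y yx; apply: homothety_neighbourhood cvx _ rhoO x'h _; first by rewrite lam0.
    move=> i; have := yx i; have := xx' i; rewrite ler_norml !ltr_norml.
    by move: sigh h0 => ? ? /andP[? ?] /andP[? ?]; apply/andP; split; lra.
  pose q := corner sig (cell sig x).
  have hr0 : 0 < h / r by rewrite divr_gt0.
  have rh0 : 0 < r / h by rewrite divr_gt0.
  (* Scaling by [r / h] maps the cell onto the cube of side [s] and balls of radius [h] onto balls
     of radius [r]. *)
  have [|y ycs xy] := covs ((r / h) *: (x - q)).
    move=> i; have -> : ((r / h) *: (x - q)) ord0 i = r / h * (x ord0 i - q ord0 i).
      by rewrite !mxE.
    have := cellP x i sigp; rewrite -/q => /andP[h1 h2].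
    rewrite mulr_ge0 ?(ltW rh0) ?subr_ge0//=.
    have -> : s = r / h * sig by rewrite /sig; field; rewrite !gt_eqF.
    by rewrite ler_pM2l//; lra.
  exists (q + (h / r) *: y).
    rewrite mem_cat; apply/orP; left; apply/allpairsP; exists (cell sig x, y); split => //=.
    by rewrite mem_filter xl andbT; apply/asboolP; exists x'.
  have -> : x - (q + (h / r) *: y) = (h / r) *: ((r / h) *: (x - q) - y).
    by apply/rowP => i; rewrite !mxE; field; rewrite !gt_eqF.
  rewrite dotvZl dotvZr mulrA -expr2.
  apply: (@le_trans _ _ ((h / r) ^+ 2 * r ^+ 2)).
    by rewrite ler_wpM2l ?sqr_ge0// -enorm_le_sqr// ltW.
  by rewrite -exprMn divfK ?gt_eqF.
- rewrite size_cat !size_allpairs -cardE card_ffun !card_ord.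
  have sgd : sig ^+ d * rs = h ^+ d.
    by rewrite /rs -exprMn /sig; congr (_ ^+ _); field; rewrite !gt_eqF.
  apply: le_trans total; rewrite -sgd mulrA ler_pM2r// natrD !natrM mulrDl.
  rewrite -/N -/Kd.
  have u1 : (size ld)%:R + (size lb)%:R = (size l)%:R :> R by rewrite -natrD lsz.
  have u2 : (size lb)%:R * sig ^+ d <= mu + eta - lam ^+ d * mu.
    by move: lcnt; rewrite -/mu -u1 mulrDl; move: ldcnt; lra.
  have u3 : (size ld)%:R * sig ^+ d <= mu + eta.
    apply: le_trans lcnt; rewrite -u1 ler_wpM2r ?exprn_ge0 ?(ltW sigp)//.
    by rewrite lerDl.
  rewrite [_ * N%:R]mulrC [_ * Kd]mulrC -!mulrA lerD// ler_wpM2l// ltW.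
Qed.

End node_nets.

(** * The asymptotic upper bound *)

Section assembly.
Context {R : realType} {d : nat}.
Local Notation V := 'rV[R]_d.
Context (d0 : (0 < d)%N).

Lemma Theta_ge0 : (0 <= @Theta R d)%E.
Proof.
apply: le_ereal_inf_tmp => _ [r [c [_ ->]]].
apply: le_ereal_sup_tmp; eexists; first by exists 0.
apply: le_ereal_inf_tmp => _ [T _ <-].
apply: mule_ge0; first by apply: nneseries_ge0 => k _ _; exact: leb_outer_ge0.
by rewrite lee_fin invr_ge0 fine_ge0// leb_outer_ge0.
Qed.

Lemma convex_body_leb_outer_fin (O : set V) : convex_body O -> leb_outer O \is a fin_num.
Proof.
move=> [_ /compact_coord_bound[M M0 OM] _].
exact: (leb_outer_sub_cube_fin d0 (ltW M0)).
Qed.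

Lemma modulus_eps (K C : R) (O : set V) : 0 <= K -> 0 <= C ->
  forall x, O x -> forall e : R, 0 < e -> exists2 r : R, 0 < r &
    forall z, O z -> (forall i, `|z ord0 i - x ord0 i| < r) ->
    K * (C * enorm (z - x) + dotv (z - x) (z - x)) < e.
Proof.
move=> K0 C0 x Ox e e0.
pose q := K * (C + 1) + 1.
have KC : 0 <= K * (C + 1) by rewrite mulr_ge0 ?addr_ge0.
have q0 : 0 < q by rewrite ltr_wpDl.
pose m := Num.min 1 (e / q).
have m0 : 0 < m by rewrite lt_min ltr01 divr_gt0.
exists (m / d.+1%:R); first by rewrite divr_gt0.
move=> z Oz zx.
have : enorm (z - x) < d.+1%:R * (m / d.+1%:R).
  apply: enorm_lt_coord; first by rewrite divr_gt0.
  by move=> i; rewrite !mxE ltW.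
rewrite mulrC divfK ?pnatr_eq0// lt_min => /andP[E1 E2].
have En := enorm_ge0 (z - x); rewrite -enorm_sqr.
set E := enorm _ in E1 E2 En *.
have EE : E ^+ 2 <= E by rewrite expr2 ler_piMr// ltW.
have : K * (C * E + E ^+ 2) <= K * (C + 1) * E.
  by rewrite -mulrA ler_wpM2l// mulrDl mul1r lerD2l.
move: E2; rewrite ltr_pdivlMr// => E2 /le_lt_trans; apply.
by apply: le_lt_trans E2; rewrite mulrC ler_wpM2l// /q lerDl.
Qed.

Lemma Rn_le (O : set V) (p q : R) : convex_body O ->
  exists2 kap : R, 0 <= kap & forall (h : R) (xi : seq V) n, 0 < h <= 1 -> kap * h < 1 ->
    (forall y, y \in xi -> O y) -> node_net O xi h -> (size xi <= n)%N ->
    (Rn O (WPD p q O) n <= ((1 - kap * h)^-1 * h ^+ 2 / 4)%:E)%E.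
Proof.
move=> bO; have [kap [C [kap0 C0 est]]] := zero_info_estimates p q bO.
exists kap => // h xi n h01 kh xiO net sz.
apply: ge_ereal_inf; exists (rec_err O (WPD p q O) (undup xi)).
  exists (undup xi) => //=; split; first exact: undup_uniq.
    exact: leq_trans (size_undup _) sz.
  by move=> y; rewrite mem_undup => /xiO.
apply: (@rec_err_le _ _ p q _ O (undup xi)
  (fun x z => (1 - kap * h)^-1 * (C * enorm (z - x) + dotv (z - x) (z - x)))).
  by apply: modulus_eps => //; rewrite invr_ge0 subr_ge0 ltW.
move=> fg W zero; apply: (est h xi fg h01 kh W _ net) => y yxi.
have [|-> ->] := zero y; first by rewrite mem_undup.
by split => //; exact: xiO.
Qed.

Lemma limn_esup_le_eventually (u : nat -> \bar R) (l : \bar R) N :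
  (forall n, (N <= n)%N -> (u n <= l)%E) -> (limn_esup u <= l)%E.
Proof.
move=> H; apply: ge_ereal_inf; eexists.
  by exists [set n | (N <= n)%N] => //; exists N.
by apply: ge_ereal_sup => _ [n Nn <-]; exact: H.
Qed.

(** The net of mesh [h] with [h ^+ d = C / n%:R] has at most [n] nodes, and [n%:R]^ al * h ^+
    2[is then the constant]C [^ al]. *)
Lemma Rn_eventually_le (O : set V) (p q x y : R) : convex_body O -> 0 <= x ->
  (@Theta R d * leb_outer O * ((fine (@unit_ball_vol R d))^-1)%:E = x%:E)%E ->
  (@Theta R d < +oo)%E -> x `^ (2 / d%:R) < y ->
  (limn_esup (fun n : nat => (n%:R `^ (2 / d%:R))%:E * Rn O (WPD p q O) n)
   <= (4^-1 * y)%:E)%E.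
Proof.
move=> bO x0 xE Tfin xy.
set al := 2 / d%:R.
have d0' : 0 < d%:R :> R by rewrite ltr0n.
have al0 : 0 < al by rewrite divr_gt0.
(* An intermediate value: [x]^ al < y1[leaves room for a constant]C > x[with]C [^ al = y1], and
   [y1 < y] absorbs the factor [(1 - kap * h)^-1]. *)
pose y1 := (x `^ al + y) / 2.
have xy1 : x `^ al < y1 by rewrite /y1; lra.
have y1y : y1 < y by rewrite /y1; lra.
have y10 : 0 < y1 by apply: le_lt_trans xy1; exact: powR_ge0.
have y0 : 0 < y by exact: lt_trans y1y.
pose C := y1 `^ al^-1.
have C0 : 0 < C by exact: powR_gt0.
have Cal : C `^ al = y1 by rewrite /C -powRrM mulVf ?gt_eqF// powRr1// ltW.
have xC : x < C.
  rewrite ltNge; apply/negP => Cx.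
  have : C `^ al <= x `^ al by rewrite ge0_ler_powR ?nnegrE ?(ltW al0) ?(ltW C0).
  by rewrite Cal leNgt xy1.
have Ofin := convex_body_leb_outer_fin bO.
have [|h0 h00 net] := @exists_node_net R d d0 O C bO Ofin Tfin; first by rewrite xE lte_fin.
have [kap kap0 Rle] := Rn_le p q bO.
have k1 : 0 < kap + 1 by rewrite ltr_wpDl.
(* [h < g] yields [kap * h <= 1 - y1 / y], that is [y1 * (1 - kap * h)^-1 <= y]. *)
pose g := (1 - y1 / y) / (kap + 1).
have yy : y1 / y < 1 by rewrite ltr_pdivrMr// mul1r.
have g0 : 0 < g by rewrite divr_gt0// subr_gt0.
pose h1 := Num.min h0 (Num.min 1 g).
have h10 : 0 < h1 by rewrite !lt_min h00 ltr01.
pose N := (Num.truncn (C / h1 ^+ d)).+1.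
apply: (@limn_esup_le_eventually _ _ N) => n Nn.
have n0 : 0 < n%:R :> R by rewrite ltr0n (leq_trans _ Nn).
have Cn : C / n%:R < h1 ^+ d.
  rewrite ltr_pdivrMr// mulrC -ltr_pdivrMr ?exprn_gt0//.
  by apply: (lt_le_trans (truncnS_gt _)); rewrite ler_nat.
pose h := (C / n%:R) `^ d%:R^-1.
have Cn0 : 0 < C / n%:R by rewrite divr_gt0.
have hp : 0 < h by exact: powR_gt0.
have hd : h ^+ d = C / n%:R.
  by rewrite -powR_mulrn ?(ltW hp)// /h -powRrM mulVf ?gt_eqF// powRr1// ltW.
have hh1 : h < h1.
  rewrite ltNge; apply/negP => hh1.
  have : h1 ^+ d <= h ^+ d by rewrite lerXn2r ?nnegrE ?(ltW hp) ?(ltW h10).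
  by rewrite hd leNgt Cn.
move: (hh1); rewrite !lt_min => /andP[hh0 /andP[hlt1 hg]].
have kh : kap * h <= 1 - y1 / y.
  have : h * (kap + 1) < 1 - y1 / y by rewrite -ltr_pdivlMr.
  by move: hp; rewrite mulrDr mulr1 mulrC; lra.
have y1y0 : 0 < y1 / y by rewrite divr_gt0.
have kh1 : kap * h < 1 by lra.
have [|xi [xiO nxi sz]] := net h; first by rewrite hp.
have szn : (size xi <= n)%N.
  move: sz; rewrite hd mulrCA -ler_pdivlMl// mulVf ?gt_eqF//.
  by rewrite ler_pdivrMr// mul1r ler_nat.
have hle : 0 < h <= 1 by rewrite hp ltW.
have := Rle h xi n hle kh1 xiO nxi szn.
have nal0 : (0 <= (n%:R `^ al)%:E)%E by rewrite lee_fin powR_ge0.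
move=> /(lee_wpmul2l nal0) /le_trans; apply.
rewrite -EFinM lee_fin.
have nh : n%:R `^ al * h ^+ 2 = y1.
  have -> : h ^+ 2 = (C / n%:R) `^ al.
    by rewrite -powR_mulrn ?(ltW hp)// /h -powRrM [d%:R^-1 * _]mulrC.
  by rewrite -powRM ?(ltW Cn0) ?ler0n// mulrCA mulfV ?gt_eqF// mulr1 Cal.
have -> : n%:R `^ al * ((1 - kap * h)^-1 * h ^+ 2 / 4) =
  4^-1 * (y1 * (1 - kap * h)^-1) by rewrite -nh; ring.
rewrite ler_pM2l// ler_pdivrMr ?subr_gt0//.
have : y * (y1 / y) <= y * (1 - kap * h) by rewrite ler_pM2l//; lra.
by rewrite mulrCA mulfV ?gt_eqF// mulr1.
Qed.

End assembly.

Theorem theorem1 (R : realType) (d : nat) (O : set 'rV[R]_d) (p q : R) :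
  (0 < d)%N -> convex_body O ->
  (limn_esup (fun n : nat =>
      (n%:R `^ (2 / d%:R))%:E * Rn O (WPD p q O) n)
   <= (4^-1)%:E * ((@Theta R d * leb_outer O
                     * ((fine (@unit_ball_vol R d))^-1)%:E) `^ (2 / d%:R)))%E.
Proof.
move=> d0 bO.
have d0' : 0 < d%:R :> R by rewrite ltr0n.
have al0 : 0 < 2 / d%:R :> R by rewrite divr_gt0.
have Ofin := convex_body_leb_outer_fin d0 bO.
have O0 : (0 < leb_outer O)%E by have [_ _] := bO; exact: leb_outer_interior_gt0.
have nu0 : (0 < ((fine (@unit_ball_vol R d))^-1)%:E)%E.
  by rewrite lte_fin invr_gt0 unit_ball_vol_fine_gt0.
have T0 := @Theta_ge0 R d.
(* If [Theta] were infinite, the right-hand side would be infinite too, since the volumes of the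
   body and of the unit ball are positive. *)
have [Too|Tfin] := eqVneq (@Theta R d) +oo%E.
  rewrite Too gt0_mulye// gt0_mulye// poweRyr; last by rewrite gt_eqF.
  by rewrite gt0_muley ?leey// lte_fin invr_gt0.
have Tlt : (@Theta R d < +oo)%E by rewrite ltey.
have Tf : @Theta R d \is a fin_num by rewrite ge0_fin_numE.
set X := (_ * _ * _)%E.
have X0 : (0 <= X)%E by rewrite !mule_ge0// ltW.
have XE : X = (fine X)%:E by rewrite fineK// !fin_numM.
rewrite XE poweR_EFin -EFinM.
(* [Rn_eventually_le] needs a strict bound; the margin [e] outside the factor [4^-1] becomes [4 * e]
   inside. *)
apply/lee_addgt0Pr => e e0.
have -> : ((4^-1 * fine X `^ (2 / d%:R))%:E + e%:E =
    (4^-1 * (fine X `^ (2 / d%:R) + 4 * e))%:E)%E.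
  by rewrite -EFinD; congr EFin; field.
apply: (@Rn_eventually_le R d d0 O p q (fine X) _ bO (fine_ge0 X0) XE Tlt).
by rewrite ltrDl mulr_gt0.
Qed.
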